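(* For all positive integers $r,s$, $$p_{r,s}=a_{r,s}\quad\Longleftrightarrow\quad a_{r,s}\ge b_{r,s},$$ where $$a_{r,s}:=\frac{\log(r+s+1)}{\log(r+1)+\log(s+1)},\qquad b_{r,s}:=\frac{r(r+2)+s(s+2)}{(r+s)(r+s+2)},$$ and $p_{r,s}$ is the largest admissible exponent for $(r,s)$.
   Context: For an integer $n\ge 0$ and $0\le t\le 1$, put $G_n(t):=1+t+\cdots+t^n$. For positive integers $r,s$, a real number $p>0$ is called admissible for $(r,s)$ if $$G_{r+s}(t^p)\ge G_r(t)^p\,G_s(t)^p\qquad\text{for all }0\le t\le 1,$$ and $p=0$ is declared admissible as well. $p_{r,s}$ denotes the largest admissible exponent for $(r,s)$ (it exists: the set of admissible exponents is a closed bounded interval $[0,p_{r,s}]$). *)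

(* Defs.v *)
From mathcomp Require Import all_boot all_order all_algebra.
From mathcomp Require Import all_classical all_reals all_analysis.
Set Implicit Arguments.
Unset Strict Implicit.
Unset Printing Implicit Defensive.
Import Order.TTheory GRing.Theory Num.Theory.
Import numFieldNormedType.Exports.
Local Open Scope classical_set_scope.
Local Open Scope ring_scope.

Definition G (R : realType) (n : nat) (t : R) : R := \sum_(i < n.+1) t ^+ i.

(* For 0 < p, 0 `^ p = 0 and otherwise t `^ p = expR (p * ln t), so powR is the
   usual real power on [0, +oo[. *)
Definition admissible (R : realType) (r s : nat) (p : R) : Prop :=
  p = 0 \/
  (0 < p /\ forall t : R, 0 <= t <= 1 ->
     G (r + s) (t `^ p) >= G r t `^ p * G s t `^ p).

Definition is_largest_admissible (R : realType) (r s : nat) (p : R) : Prop :=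
  admissible r s p /\ forall q : R, admissible r s q -> q <= p.

(* xget 0 A is some element of A, or 0 if A is empty; the second case does not
   occur for 0 < r and 0 < s, by largest_admissibleP below. *)
Definition largest_admissible (R : realType) (r s : nat) : R :=
  xget 0 [set p : R | is_largest_admissible r s p].

Definition a_rs (R : realType) (r s : nat) : R :=
  ln (r + s + 1)%:R / (ln (r + 1)%:R + ln (s + 1)%:R).

Definition b_rs (R : realType) (r s : nat) : R :=
  (r%:R * (r%:R + 2) + s%:R * (s%:R + 2)) /
  ((r%:R + s%:R) * (r%:R + s%:R + 2)).

Lemma G_at1 (R : realType) n : G n (1 : R) = n.+1%:R.
Proof.
rewrite /G (eq_bigr (fun=> 1)) => [|i _]; last by rewrite expr1n.
by rewrite sumr_const card_ord.
Qed.

Lemma G_at0 (R : realType) n : G n (0 : R) = 1.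
Proof.
by rewrite /G big_ord_recl expr0 big1 ?addr0 // => i _; rewrite expr0n.
Qed.

Lemma G_gt0 (R : realType) n (t : R) : 0 <= t -> 0 < G n t.
Proof.
move=> t0; rewrite /G big_ord_recl expr0 ltr_pwDl // sumr_ge0 // => i _.
exact: exprn_ge0.
Qed.

Lemma powR_continuous_exponent (R : realType) (a : R) :
  0 < a -> continuous (fun p : R => a `^ p).
Proof.
move=> a0 x; rewrite /powR gt_eqF //.
apply: (@continuous_comp _ _ _ (fun p : R => p * ln a) expR).
  by apply: cvgMr_tmp; exact: cvg_id.
exact: continuous_expR.
Qed.

Lemma G_continuous (R : realType) n : continuous (@G R n).
Proof.
elim: n => [|n IHn] x.
  have -> : @G R 0 = fun=> 1 by apply/funext => t; rewrite /G big_ord1 expr0.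
  exact: cvg_cst.
have -> : @G R n.+1 = fun t => G n t + t ^+ n.+1.
  by apply/funext => t; rewrite /G big_ord_recr.
apply: cvgD; [exact: IHn | exact: exprn_continuous].
Qed.

Lemma admissible_le_a_rs (R : realType) (r s : nat) (p : R) :
  (0 < r)%N -> (0 < s)%N -> admissible r s p -> p <= a_rs R r s.
Proof.
move=> r0 s0.
have lnr : 0 < ln (r + 1)%:R :> R by rewrite ln_gt0 // ltr1n addn1 ltnS.
have lns : 0 < ln (s + 1)%:R :> R by rewrite ln_gt0 // ltr1n addn1 ltnS.
have d0 : 0 < ln (r + 1)%:R + ln (s + 1)%:R :> R by rewrite addr_gt0.
case=> [->|[p0 /(_ 1)]].
  by rewrite divr_ge0 ?(ltW d0)// ln_ge0 // ler1n addn1.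
rewrite lexx ler01 powR1 !G_at1 => /(_ isT) h.
rewrite /a_rs ler_pdivlMr // mulrDr -!ln_powR -lnM ?posrE ?powR_gt0 ?ltr0n ?addn1 //.
by rewrite ler_ln ?posrE ?mulr_gt0 ?powR_gt0 ?ltr0n.
Qed.

Lemma ex_largest_admissible (R : realType) (r s : nat) :
  (0 < r)%N -> (0 < s)%N -> exists p : R, is_largest_admissible r s p.
Proof.
move=> r0 s0; pose A := [set p : R | admissible r s p].
have A0 : A 0 by left.
have ubA : has_ubound A.
  by exists (a_rs R r s) => p /=; exact: admissible_le_a_rs.
have supA : has_sup A by split=> //; exists 0.
exists (sup A); split; last by move=> q Aq; exact: ub_le_sup.
have : 0 <= sup A by exact: ub_le_sup.
rewrite le_eqVlt => /orP[/eqP<-|sup0]; first by left.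
right; split=> // t /andP[t0 t1].
move: t0; rewrite le_eqVlt => /orP[/eqP<-|t0].
  by rewrite powR0 ?gt_eqF // !G_at0 powR1 mulr1.
rewrite leNgt; apply/negP => lt.
pose f p := G r t `^ p * G s t `^ p - G (r + s) (t `^ p).
have cf : {for sup A, continuous f}.
  apply: cvgB; first apply: cvgM.
  - by apply: powR_continuous_exponent; rewrite G_gt0 // ltW.
  - by apply: powR_continuous_exponent; rewrite G_gt0 // ltW.
  - apply: (@continuous_comp _ _ _ (fun p : R => t `^ p) (G (r + s))).
      exact: powR_continuous_exponent.
    exact: G_continuous.
have fs : 0 < f (sup A) by rewrite subr_gt0.
have : \forall x \near sup A, 0 < f x by exact: (cvgr_gt _ cf).
move=> /nbhs_ballP[e /= e0 He].
have me0 : 0 < Num.min e (sup A) by rewrite lt_min e0.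
have [q Aq qlt] := sup_adherent me0 supA.
have qle : q <= sup A by exact: ub_le_sup.
have q0 : 0 < q.
  apply: le_lt_trans qlt; rewrite subr_ge0 ge_min lexx orbT //.
have : 0 < f q.
  apply: He; rewrite /ball /= ger0_norm ?subr_ge0 // ltrBlDl -ltrBlDr.
  by apply: le_lt_trans qlt; rewrite lerB // ge_min lexx.
rewrite subr_gt0 ltNge.
case: Aq => [q00|[_ -> //]]; first by rewrite q00 ltxx in q0.
by rewrite (ltW t0).
Qed.

Lemma largest_admissibleP (R : realType) (r s : nat) :
  (0 < r)%N -> (0 < s)%N ->
  is_largest_admissible r s (largest_admissible R r s).
Proof.
move=> r0 s0.
exact: (xgetPex 0 (ex_largest_admissible R r0 s0)).
Qed.

(* Main.v *)
Require Import Defs.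
From mathcomp Require Import all_boot all_order all_algebra.
From mathcomp Require Import all_classical all_reals all_analysis.
From mathcomp Require Import ring lra zify.
Set Implicit Arguments.
Unset Strict Implicit.
Unset Printing Implicit Defensive.
Import Order.TTheory GRing.Theory Num.Theory.
Import numFieldNormedType.Exports.
Local Open Scope ring_scope.

(** With t = exp (-2x), x > 0, one has G_n(t) = exp (-nx) sinh ((n+1)x) / sinh x.
The exponential factors cancel from the inequality, whose logarithm becomes
D(x) >= 0 for the defect
  D(x) = h_(r+s)(px) - p h_r(x) - p h_s(x),  h_n(x) = ln (sinh ((n+1)x) / sinh x).
As x -> 0 this only says p <= a.  Hence p_(r,s) = a if and only if the exponent a
itself is admissible.  For p = a the defect tends to 0 both at 0 and at infinity,
and its second derivative at 0 has the sign of p n (n+2) - r(r+2) - s(s+2), where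
n = r + s, that is, of a - b.  So a < b makes D negative near 0.

Conversely let p = a >= b.  It is enough that D first increases and then
decreases: if D were negative at some point, it would stay below a negative
constant from there on, whereas D >= - p n exp (-2x).  All functions
involved are built from k coth (k x), which solves c' = k^2 - c^2, and the shape
of D is found by eliminating one of them at a time.  Let
  al = h_r', be = h_s', H = al + be, j = coth x - p coth (px),
  C = p n (n+2) - r(r+2) - s(s+2) >= 0.
- D' has the same sign as E := D' times an integrating factor, and E' is a
  positive multiple of Y := C - p H^2 + al^2 + be^2 + 2 j H
  ([is_derive_weighted_slope]); both coth ((n+1)px) and the derivatives of al and
  be have disappeared.  So D has the required shape if Y, once negative, stays
  negative.
- Y / H^2 tends to 0 at infinity, and its derivative is a positive multiple of
    1 - C (1/H) (H'/V) - ((al - be)/H) (U/V),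
  where U = al be' - al' be and V = H j' - H' j ([is_derive_rate_ratio]).  For
  r >= s every factor here is nonnegative and nonincreasing ([rate_num_gt0]), so
  the derivative, once positive, stays positive.  Thus Y / H^2 decreases and then
  increases to its limit 0, which gives the property of Y
  ([slope_rate_lt0]).

The monotonicity of the factors rests on a single fact ([dgap_tp2]): the
derivatives of l coth (lx) - k coth (kx) for increasing pairs (k, l) have
monotone ratios.  It follows from the monotonicity of a chord slope in the index
([chord_slope_ndecr]), which reduces to sinh z >= z and z^2 >= 3 (z coth z - 1).
The Wronskians U and V, multiplied by sinh^2, have derivatives that are
products of such functions, and l'Hopital's rule for monotonicity
([ratio_nincr]) passes from these derivatives to U / V. *)

(** * Calculus on the positive half-line *)

Section Calculus.
Context {R : realType}.
Implicit Types (f g df dg : R -> R) (x y a b : R).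

(** The rules of differentiation for functions written pointwise: they compose to
the derivative of an explicit expression, which [is_derive_eq] and [field] then
put in the desired form. *)
Lemma is_derive_const (c x : R) : is_derive x (1 : R) (fun=> c) 0.
Proof. exact: is_derive_cst. Qed.

Lemma is_derive_idf x : is_derive x (1 : R) (fun t => t) 1.
Proof. exact: is_derive_id. Qed.

Lemma is_deriveDf f g x a b : is_derive x (1 : R) f a -> is_derive x (1 : R) g b ->
  is_derive x (1 : R) (fun t => f t + g t) (a + b).
Proof. exact: is_deriveD. Qed.

Lemma is_deriveNf f x a : is_derive x (1 : R) f a ->
  is_derive x (1 : R) (fun t => - f t) (- a).
Proof. exact: is_deriveN. Qed.

Lemma is_deriveBf f g x a b : is_derive x (1 : R) f a -> is_derive x (1 : R) g b ->
  is_derive x (1 : R) (fun t => f t - g t) (a - b).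
Proof. exact: is_deriveB. Qed.

Lemma is_deriveMf f g x a b : is_derive x (1 : R) f a -> is_derive x (1 : R) g b ->
  is_derive x (1 : R) (fun t => f t * g t) (a * g x + f x * b).
Proof.
move=> df dg; apply: is_derive_eq (is_deriveM df dg) _.
by rewrite /GRing.scale /= addrC mulrC.
Qed.

Lemma is_deriveVf f x a : is_derive x (1 : R) f a -> f x != 0 ->
  is_derive x (1 : R) (fun t => (f t)^-1) (- a / f x ^+ 2).
Proof.
move=> df fx; apply: is_derive_eq (is_deriveV fx df) _.
by rewrite /GRing.scale /= mulrC mulNr mulrN.
Qed.

Lemma is_derive_div f g x a b :
  is_derive x (1 : R) f a -> is_derive x (1 : R) g b -> g x != 0 ->
  is_derive x (1 : R) (fun t => f t / g t) ((a * g x - f x * b) / g x ^+ 2).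
Proof.
move=> df dg gx; apply: is_derive_eq (is_deriveMf df (is_deriveVf dg gx)) _.
by field.
Qed.

Lemma is_derive_scaling (k x a : R) f : is_derive (k * x) (1 : R) f a ->
  is_derive x (1 : R) (fun t => f (k * t)) (k * a).
Proof.
move=> df; have dk : is_derive x (1 : R) (fun t => k * t) k.
  apply: is_derive_eq (is_deriveMf (is_derive_const k x) (is_derive_idf x)) _.
  by rewrite mul0r add0r mulr1.
by apply: is_derive_eq (is_derive1_comp df dk) _; rewrite mulrC.
Qed.

Lemma MVT_pos f df x y : (forall t : R, 0 < t -> is_derive t (1 : R) f (df t)) ->
  0 < x -> x < y -> exists2 t, x < t < y & f y - f x = df t * (y - x).
Proof.
move=> fdf x0 xy.
have [t|t|t] := @MVT R f df x y xy.
- by rewrite in_itv /= => /andP[xt _]; apply: fdf; exact: lt_trans xt.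
- apply: derivable_within_continuous => {}t; rewrite in_itv /= => /andP[xt _].
  by apply: (@ex_derive _ _ _ _ _ _ (df t)); apply: fdf; exact: lt_le_trans xt.
by rewrite in_itv /=; exists t.
Qed.

Lemma ndecr_pos f df x y : (forall t : R, 0 < t -> is_derive t (1 : R) f (df t)) ->
  0 < x -> x <= y -> (forall t, x < t < y -> 0 <= df t) -> f x <= f y.
Proof.
move=> fdf x0; rewrite le_eqVlt => /orP[/eqP->//|xy] df0.
have [t /df0 dft e] := MVT_pos fdf x0 xy.
by rewrite -subr_ge0 e mulr_ge0 // subr_ge0 ltW.
Qed.

Lemma nincr_pos f df x y : (forall t : R, 0 < t -> is_derive t (1 : R) f (df t)) ->
  0 < x -> x <= y -> (forall t, x < t < y -> df t <= 0) -> f y <= f x.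
Proof.
move=> fdf x0 xy df0; rewrite -lerN2.
apply: (@ndecr_pos (fun t => - f t) (fun t => - df t)) => // [t t0|t /df0 dft].
  by apply: is_deriveNf; exact: fdf.
by rewrite oppr_ge0.
Qed.

Lemma incr_pos f df x y : (forall t : R, 0 < t -> is_derive t (1 : R) f (df t)) ->
  0 < x -> x < y -> (forall t, x < t < y -> 0 < df t) -> f x < f y.
Proof.
move=> fdf x0 xy df0.
have [t /df0 dft e] := MVT_pos fdf x0 xy.
by rewrite -subr_gt0 e mulr_gt0 // subr_gt0.
Qed.

(** The lower bound says that f is at least 0 in the limit at 0+, so f has to
descend to reach a negative value.  A linear bound near 0 is all that is known of
the functions below, which are not defined at 0. *)
Lemma neg_derive_before f df k x :
  (forall t : R, 0 < t -> is_derive t (1 : R) f (df t)) ->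
  (forall t, 0 < t < 1 -> - (k * t) <= f t) -> 0 < x -> f x < 0 ->
  exists2 t, 0 < t < x & df t < 0.
Proof.
move=> fdf fk x0 fx0.
(* A point y so close to 0 that - (k y) already exceeds the negative f x. *)
have h0 : 0 < `|k| + 1 by rewrite ltr_wpDl.
pose y := Num.min (Num.min (x / 2) (1 / 2)) (- f x / 2 / (`|k| + 1)).
have y0 : 0 < y by rewrite !lt_min !divr_gt0 // oppr_gt0.
have yx : y < x by rewrite !gt_min; apply/orP; left; apply/orP; left; lra.
have y1 : y < 1 by rewrite !gt_min; apply/orP; left; apply/orP; right; lra.
have fy : f x < f y.
  apply: lt_le_trans (fk y _); last by rewrite y0.
  rewrite ltrNr.
  have : k * y <= (`|k| + 1) * y.
    by rewrite ler_pM2r // (le_trans (ler_norm k)) // lerDl.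
  move/le_lt_trans; apply.
  have : y <= - f x / 2 / (`|k| + 1) by rewrite ge_min lexx orbT.
  rewrite ler_pdivlMr // mulrC => /le_lt_trans; apply.
  by lra.
have [t /andP[yt tx] e] := MVT_pos fdf y0 yx.
exists t; first by rewrite (lt_trans y0 yt).
have : df t * (x - y) < 0 by rewrite -e subr_lt0.
by rewrite pmulr_llt0 // subr_gt0.
Qed.

Lemma ge0_of_derive f df k x :
  (forall t : R, 0 < t -> is_derive t (1 : R) f (df t)) ->
  (forall t, 0 < t < 1 -> - (k * t) <= f t) -> 0 < x ->
  (forall t, 0 < t < x -> 0 <= df t) -> 0 <= f x.
Proof.
move=> fdf fk x0 df0; rewrite leNgt; apply/negP => fx.
by have [t /df0] := neg_derive_before fdf fk x0 fx; rewrite leNgt => /negP.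
Qed.

Lemma gt0_of_derive f df k x :
  (forall t : R, 0 < t -> is_derive t (1 : R) f (df t)) ->
  (forall t, 0 < t < 1 -> - (k * t) <= f t) -> 0 < x ->
  (forall t, 0 < t < x -> 0 < df t) -> 0 < f x.
Proof.
move=> fdf fk x0 df0.
have x2 : 0 < x / 2 by rewrite divr_gt0.
have x2x : x / 2 < x by lra.
apply: le_lt_trans (incr_pos fdf x2 x2x _).
  apply: (ge0_of_derive fdf fk x2) => t /andP[t0 tx].
  by apply/ltW/df0; rewrite t0 (lt_trans tx).
by move=> t /andP[xt tx]; apply: df0; rewrite tx (lt_trans x2).
Qed.

(** The rule of l'Hopital for monotonicity: if f and g vanish at 0+ and f' / g' is
nonincreasing, then f - q g is nondecreasing before x when q is the value of
f' / g' at x, hence f' g <= f g' at x, and f / g is nonincreasing. *)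
Lemma ratio_nincr f g df dg k x y :
  (forall t : R, 0 < t -> is_derive t (1 : R) f (df t)) ->
  (forall t : R, 0 < t -> is_derive t (1 : R) g (dg t)) ->
  (forall t, 0 < t < 1 -> - (k * t) <= f t) ->
  (forall t, 0 < t < 1 -> g t <= k * t) ->
  (forall t, 0 < t -> 0 < g t) ->
  (forall t, 0 < t -> 0 < dg t) -> (forall t, 0 < t -> 0 <= df t) ->
  (forall s t, 0 < s -> s <= t -> df t / dg t <= df s / dg s) ->
  0 < x -> x <= y -> f y / g y <= f x / g x.
Proof.
move=> fdf gdg fk gk g0 dg0 df0 mono x0 xy.
have gn0 t : 0 < t -> g t != 0 by move=> /g0 /gt_eqF ->.
apply: (@nincr_pos (fun t => f t / g t)
  (fun t => (df t * g t - f t * dg t) / g t ^+ 2)) => // [t t0|t /andP[xt _]].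
  by apply: is_derive_div; [exact: fdf|exact: gdg|exact: gn0].
have t0 : 0 < t by exact: lt_trans xt.
rewrite pmulr_lle0 ?invr_gt0 ?exprn_gt0 ?g0 // subr_le0.
pose q := df t / dg t.
have q0 : 0 <= q by rewrite divr_ge0 ?df0 // ltW ?dg0.
suff : 0 <= f t - q * g t.
  rewrite /q subr_ge0 mulrAC ler_pdivrMr ?dg0 //.
apply: (@ge0_of_derive (fun u => f u - q * g u) (fun u => df u - q * dg u)
  (k + q * k)) => // [u u0|u /[dup] /andP[u0 _] u1|u /andP[u0 ut]].
- apply: is_derive_eq (is_deriveBf (fdf _ u0)
    (is_deriveMf (is_derive_const q u) (gdg _ u0))) _.
  by rewrite mul0r add0r.
- have := fk _ u1; have := ler_wpM2l q0 (gk _ u1); lra.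
- by rewrite subr_ge0 -ler_pdivlMr ?dg0 // mono // ltW.
Qed.

Lemma incr_from0 (f df : R -> R) x : (forall t : R, is_derive t (1 : R) f (df t)) ->
  f 0 = 0 -> (forall t, 0 < t -> 0 < df t) -> 0 < x -> 0 < f x.
Proof.
move=> fdf f00 df0 x0.
have [|t] := @MVT R f df 0 x x0.
- apply: derivable_within_continuous => t _.
  by apply: (@ex_derive _ _ _ _ _ _ (df t)).
- rewrite in_itv /= => /andP[t0 _]; rewrite f00 !subr0 => ->.
  by rewrite mulr_gt0 // df0.
Qed.

End Calculus.

(** * The functions z coth z and (z / sinh z)^2 *)

Section Hyperbolic.
Context {R : realType}.
Implicit Types (x y z k : R).

Definition sinh z : R := (expR z - expR (- z)) / 2.
Definition cosh z : R := (expR z + expR (- z)) / 2.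

Lemma is_derive_expRN z : is_derive z (1 : R) (fun t : R => expR (- t)) (- expR (- z)).
Proof.
have dN : is_derive z (1 : R) (fun t : R => - t) (-1) := is_deriveNf (is_derive_idf z).
have := @is_derive1_comp R expR (fun t : R => - t) z _ _ (is_derive_expR (- z)) dN.
by rewrite mulrN1.
Qed.

Lemma is_derive_sinh z : is_derive z (1 : R) sinh (cosh z).
Proof.
apply: is_derive_eq (is_deriveMf (is_deriveBf (is_derive_expR z)
  (is_derive_expRN z)) (is_derive_const 2^-1 z)) _.
by rewrite /cosh opprK mulr0 addr0.
Qed.

Lemma is_derive_cosh z : is_derive z (1 : R) cosh (sinh z).
Proof.
apply: is_derive_eq (is_deriveMf (is_deriveDf (is_derive_expR z)
  (is_derive_expRN z)) (is_derive_const 2^-1 z)) _.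
by rewrite /sinh mulr0 addr0.
Qed.

Lemma cosh2_sinh2 z : cosh z ^+ 2 - sinh z ^+ 2 = 1.
Proof.
have : expR z * expR (- z) = 1 by rewrite expRN divff // gt_eqF ?expR_gt0.
rewrite /cosh /sinh => e.
by rewrite -[RHS]e; field.
Qed.

Lemma sinh0 : sinh 0 = 0.
Proof. by rewrite /sinh oppr0 subrr mul0r. Qed.

Lemma sinh_gt0 z : 0 < z -> 0 < sinh z.
Proof. by move=> z0; rewrite divr_gt0 // subr_gt0 ltr_expR gtrN. Qed.

Lemma cosh_gt1 z : 0 < z -> 1 < cosh z.
Proof.
move=> z0; rewrite -subr_gt0.
apply: (@incr_from0 _ (fun t => cosh t - 1) sinh) => // [t||]; last exact: sinh_gt0.
  apply: is_derive_eq (is_deriveBf (is_derive_cosh t) (is_derive_const 1 t)) _.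
  by rewrite subr0.
by rewrite /cosh oppr0 expR0; lra.
Qed.

Lemma sinh_gt_id z : 0 < z -> z < sinh z.
Proof.
move=> z0; rewrite -subr_gt0.
apply: (@incr_from0 _ (fun t => sinh t - t) (fun t => cosh t - 1)) => // [t||t t0].
- exact: is_deriveBf (is_derive_sinh t) (is_derive_idf t).
- by rewrite sinh0 subrr.
- by rewrite subr_gt0 cosh_gt1.
Qed.

Lemma sinh_lt_mul_cosh z : 0 < z -> sinh z < z * cosh z.
Proof.
move=> z0; rewrite -subr_gt0.
have df (t : R) : is_derive t (1 : R) (fun t => t * cosh t - sinh t) (t * sinh t).
  apply: is_derive_eq (is_deriveBf (is_deriveMf (is_derive_idf t)
    (is_derive_cosh t)) (is_derive_sinh t)) _.
  by rewrite mul1r addrAC subrr add0r.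
apply: (incr_from0 df) => [|t t0|//]; first by rewrite sinh0 mul0r subrr.
by rewrite mulr_gt0 // sinh_gt0.
Qed.

(** This is z^2 > 3 (z coth z - 1) before division by sinh z. *)
Lemma mul_cosh_lt z : 0 < z -> 3 * (z * cosh z) < (z ^+ 2 + 3) * sinh z.
Proof.
move=> z0; rewrite -subr_gt0.
have df (t : R) : is_derive t (1 : R) (fun t => (t * t + 3) * sinh t - 3 * (t * cosh t))
    (t * (t * cosh t - sinh t)).
  apply: is_derive_eq (is_deriveBf (is_deriveMf (is_deriveDf (is_deriveMf
    (is_derive_idf t) (is_derive_idf t)) (is_derive_const 3 t)) (is_derive_sinh t))
    (is_deriveMf (is_derive_const 3 t) (is_deriveMf (is_derive_idf t)
    (is_derive_cosh t)))) _.
  by ring.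
apply: (incr_from0 df) => [|t t0|//]; first by rewrite sinh0 !mul0r !mulr0 subrr.
by rewrite mulr_gt0 // subr_gt0 sinh_lt_mul_cosh.
Qed.

Definition zcoth z : R := z * cosh z / sinh z.

Lemma is_derive_zcoth z : 0 < z ->
  is_derive z (1 : R) zcoth ((zcoth z - zcoth z ^+ 2 + z ^+ 2) / z).
Proof.
move=> z0; have s0 : sinh z != 0 by rewrite gt_eqF ?sinh_gt0.
apply: is_derive_eq (is_derive_div (is_deriveMf (is_derive_idf z)
  (is_derive_cosh z)) (is_derive_sinh z) s0) _.
by rewrite /zcoth; field; rewrite s0 gt_eqF.
Qed.

Lemma zcoth_gt1 z : 0 < z -> 1 < zcoth z.
Proof.
by move=> z0; rewrite ltr_pdivlMr ?sinh_gt0 // mul1r sinh_lt_mul_cosh.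
Qed.

Lemma zcoth_lt z : 0 < z -> 3 * (zcoth z - 1) < z ^+ 2.
Proof.
move=> z0; have := mul_cosh_lt z0.
rewrite -ltr_pdivrMr ?sinh_gt0 // -mulrA => h.
by rewrite /zcoth; lra.
Qed.

(** (z / sinh z)^2, written in terms of z and z coth z so that the derivatives of both
functions are again rational in them; see [zcsch2E]. *)
Definition zcsch2 z := zcoth z ^+ 2 - z ^+ 2.

Lemma zcsch2E z : 0 < z -> zcsch2 z = (z / sinh z) ^+ 2.
Proof.
move=> z0; have s0 : sinh z != 0 by rewrite gt_eqF ?sinh_gt0.
have -> : zcsch2 z = z ^+ 2 * (cosh z ^+ 2 - sinh z ^+ 2) / sinh z ^+ 2.
  by rewrite /zcsch2 /zcoth; field.
by rewrite cosh2_sinh2; field.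
Qed.

Lemma zcsch2_gt0 z : 0 < z -> 0 < zcsch2 z.
Proof.
by move=> z0; rewrite zcsch2E // exprn_gt0 // divr_gt0 // sinh_gt0.
Qed.

Lemma zcsch2_lt1 z : 0 < z -> zcsch2 z < 1.
Proof.
move=> z0; have s0 := sinh_gt0 z0.
rewrite zcsch2E // expr_lt1 //; last by rewrite divr_ge0 // ltW.
by rewrite ltr_pdivrMr // mul1r sinh_gt_id.
Qed.

Lemma is_derive_zcsch2 z : 0 < z ->
  is_derive z (1 : R) zcsch2 (- (2 * zcsch2 z * (zcoth z - 1) / z)).
Proof.
move=> z0.
apply: is_derive_eq (is_deriveBf (is_deriveMf (is_derive_zcoth z0) (is_derive_zcoth z0))
   (is_deriveMf (is_derive_idf z) (is_derive_idf z))) _.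
by rewrite /zcsch2; field; rewrite gt_eqF.
Qed.

Lemma zcsch2_decr x y : 0 < x -> x < y -> zcsch2 y < zcsch2 x.
Proof.
move=> x0 xy; rewrite -ltrN2.
have df (t : R) : 0 < t -> is_derive t (1 : R) (fun t => - zcsch2 t)
    (- - (2 * zcsch2 t * (zcoth t - 1) / t)).
  by move=> t0; exact: is_deriveNf (is_derive_zcsch2 t0).
apply: (incr_pos df x0 xy) => t /andP[xt _]; have t0 := lt_trans x0 xt.
rewrite opprK divr_gt0 // mulr_gt0 // ?subr_gt0 ?zcoth_gt1 //.
by rewrite mulr_gt0 // zcsch2_gt0.
Qed.

(** The derivative of (z coth z) (z / sinh z)^2 with respect to (z / sinh z)^2. *)
Definition chord_slope z := zcoth z - (zcoth z - zcsch2 z) / (2 * (zcoth z - 1)).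

(** In terms of L = z coth z - 1 twice the slope is 3 L - z^2 / L + 3.  With
u = z^2 / L - L, the sign of its derivative is that of
u (u - 3) + L (4 u - 6), which is nonnegative because u + L > 3 and u > 2; these
two bounds are z^2 > 3 L and (z / sinh z)^2 < 1. *)
Lemma chord_slope_ndecr x y : 0 < x -> x <= y -> chord_slope x <= chord_slope y.
Proof.
move=> x0 xy.
have L0 z : 0 < z -> 0 < zcoth z - 1 by move=> z0; rewrite subr_gt0 zcoth_gt1.
have L00 z : 0 < z -> zcoth z - 1 != 0 by move=> /L0 /gt_eqF ->.
have dL (z : R) : 0 < z -> is_derive z (1 : R) (fun t => zcoth t - 1)
    ((zcoth z - zcoth z ^+ 2 + z ^+ 2) / z).
  move=> z0; apply: is_derive_eq (is_deriveBf (is_derive_zcoth z0) (is_derive_const 1 z)) _.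
  by rewrite subr0.
have slopeE z : 0 < z ->
    chord_slope z = (3 * (zcoth z - 1) - z * z / (zcoth z - 1) + 3) / 2.
  by move=> z0; rewrite /chord_slope /zcsch2; field; rewrite L00.
rewrite !slopeE ?(lt_le_trans x0) // ler_pM2r // lerD2r.
pose F z := 3 * (zcoth z - 1) - z * z / (zcoth z - 1).
pose dF z := ((zcoth z - 1) ^+ 2 * 3 * (z ^+ 2 - (zcoth z - 1) - (zcoth z - 1) ^+ 2)
     - z ^+ 2 * (3 * (zcoth z - 1) + (zcoth z - 1) ^+ 2 - z ^+ 2))
     / (z * (zcoth z - 1) ^+ 2).
have FdF (z : R) : 0 < z -> is_derive z (1 : R) F (dF z).
  move=> z0.
  apply: is_derive_eq (is_deriveBf (is_deriveMf (is_derive_const 3 z) (dL _ z0))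
    (is_derive_div (is_deriveMf (is_derive_idf z) (is_derive_idf z)) (dL _ z0) (L00 _ z0))) _.
  by rewrite /dF; field; rewrite L00 // gt_eqF.
apply: (ndecr_pos FdF x0 xy) => z /andP[xz _]; have z0 := lt_trans x0 xz.
rewrite divr_ge0 //; last by rewrite mulr_ge0 ?ltW ?exprn_gt0 ?L0.
have := L0 _ z0; have := zcoth_lt z0; have := zcsch2_lt1 z0; rewrite /zcsch2.
set l := zcoth z - 1; have -> : zcoth z = l + 1 by rewrite /l; ring.
set s := z ^+ 2 => h1 h2 l0.
(* Here l = L and s = z ^ 2; this is L ^ 2 (u (u + L - 3) + L (3 u - 6)). *)
have e : l ^+ 2 * 3 * (s - l - l ^+ 2) - s * (3 * l + l ^+ 2 - s) =
  (s - l ^+ 2) * (s - 3 * l) + l * (3 * (s - l ^+ 2) - 6 * l) * l.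
  by ring.
rewrite e.
have a1 : 2 * l <= s - l ^+ 2 by rewrite sqrrD1 in h1; lra.
by rewrite addr_ge0 // mulr_ge0 //; try (rewrite mulr_ge0 //); lra.
Qed.

End Hyperbolic.

(** * The family k coth (k x) *)

Section Coth.
Context {R : realType}.
Implicit Types (x y z k l m : R).

(** The slope of the curve ((z / sinh z)^2, (z coth z) (z / sinh z)^2) increases with
z; its chords over [z1, z2] and [z2, z3] are compared through the tangent
at z2. *)
Lemma zcoth_chord z1 z2 z3 : 0 < z1 -> z1 < z2 -> z2 <= z3 ->
  (zcoth z1 * zcsch2 z1 - zcoth z2 * zcsch2 z2) * (zcsch2 z2 - zcsch2 z3) <=
  (zcoth z2 * zcsch2 z2 - zcoth z3 * zcsch2 z3) * (zcsch2 z1 - zcsch2 z2).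
Proof.
move=> z10 z12 z23; have z20 := lt_trans z10 z12.
pose e := chord_slope z2.
pose F z := zcoth z * zcsch2 z - e * zcsch2 z.
pose dF z := 2 * zcsch2 z * (zcoth z - 1) / z * (e - chord_slope z).
have FdF z : 0 < z -> is_derive z (1 : R) F (dF z).
  move=> z0; apply: is_derive_eq (is_deriveBf (is_deriveMf (is_derive_zcoth z0)
    (is_derive_zcsch2 z0)) (is_deriveMf (is_derive_const e z) (is_derive_zcsch2 z0))) _.
  have L0 : zcoth z - 1 != 0 by rewrite gt_eqF // subr_gt0 zcoth_gt1.
  by rewrite /dF /chord_slope /zcsch2; field; rewrite L0 gt_eqF.
have w0 z : 0 < z -> 0 <= 2 * zcsch2 z * (zcoth z - 1) / z.
  move=> z0; rewrite ltW // divr_gt0 // mulr_gt0 ?subr_gt0 ?zcoth_gt1 //.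
  by rewrite mulr_gt0 // zcsch2_gt0.
have h12 : F z1 <= F z2.
  apply: (ndecr_pos FdF z10 (ltW z12)) => z /andP[z1z zz2].
  have z0 := lt_trans z10 z1z.
  by rewrite mulr_ge0 ?w0 // subr_ge0 chord_slope_ndecr // ltW.
have h23 : F z3 <= F z2.
  apply: (nincr_pos FdF z20 z23) => z /andP[z2z zz3].
  have z0 := lt_trans z20 z2z.
  by rewrite mulr_ge0_le0 ?w0 // subr_le0 chord_slope_ndecr // ltW.
have s12 : 0 <= zcsch2 z1 - zcsch2 z2 by rewrite subr_ge0 ltW // zcsch2_decr.
have s23 : 0 <= zcsch2 z2 - zcsch2 z3.
  move: z23; rewrite le_eqVlt => /orP[/eqP->|z23]; first by rewrite subrr.
  by rewrite subr_ge0 ltW // zcsch2_decr.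
have t12 : zcoth z1 * zcsch2 z1 - zcoth z2 * zcsch2 z2 <= e * (zcsch2 z1 - zcsch2 z2).
  by move: h12; rewrite /F; lra.
have t23 : e * (zcsch2 z2 - zcsch2 z3) <= zcoth z2 * zcsch2 z2 - zcoth z3 * zcsch2 z3.
  by move: h23; rewrite /F; lra.
apply: le_trans (ler_wpM2r s23 t12) _.
by rewrite mulrAC; apply: ler_wpM2r.
Qed.

Lemma zcoth_incr x y : 0 < x -> x < y -> zcoth x < zcoth y.
Proof.
move=> x0 xy.
apply: (incr_pos (@is_derive_zcoth R) x0 xy) => t /andP[xt _].
have t0 := lt_trans x0 xt.
rewrite divr_gt0 //; have := zcoth_gt1 t0; have := zcsch2_lt1 t0.
by rewrite /zcsch2; lra.
Qed.

Lemma zcoth_le z : 0 < z -> zcoth z <= z + 1.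
Proof.
move=> z0; have h := zcsch2_lt1 z0; have h1 := zcoth_gt1 z0.
rewrite -(@ler_pXn2r _ 2) ?nnegrE //; [|lra|lra].
by rewrite sqrrD1; move: h; rewrite /zcsch2; lra.
Qed.

(** This is k coth (k x), the solution of c' = k^2 - c^2 with a pole at 0. *)
Definition scoth k x : R := zcoth (k * x) / x.

(** (k / sinh (k x))^2, the opposite of the derivative of [scoth k]. *)
Definition scsch2 k x : R := scoth k x ^+ 2 - k ^+ 2.

Lemma scsch2E k x : 0 < x -> scsch2 k x = zcsch2 (k * x) / x ^+ 2.
Proof. by move=> x0; rewrite /scsch2 /scoth /zcsch2; field; rewrite gt_eqF. Qed.

Lemma scsch2_gt0 k x : 0 < k -> 0 < x -> 0 < scsch2 k x.
Proof.
by move=> k0 x0; rewrite scsch2E // divr_gt0 ?exprn_gt0 // zcsch2_gt0 // mulr_gt0.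
Qed.

Lemma scsch2_decr k l x : 0 < k -> k < l -> 0 < x -> scsch2 l x < scsch2 k x.
Proof.
move=> k0 kl x0; rewrite !scsch2E // ltr_pM2r ?invr_gt0 ?exprn_gt0 //.
by rewrite zcsch2_decr ?mulr_gt0 // ltr_pM2r.
Qed.

Lemma scoth_gt0 k x : 0 < k -> 0 < x -> 0 < scoth k x.
Proof.
by move=> k0 x0; rewrite divr_gt0 // (lt_trans ltr01) // zcoth_gt1 // mulr_gt0.
Qed.

Lemma scoth_gt k x : 0 < k -> 0 < x -> k < scoth k x.
Proof.
move=> k0 x0; rewrite -(@ltr_pXn2r _ 2) ?nnegrE ?ltW ?scoth_gt0 //.
by rewrite -subr_gt0; exact: scsch2_gt0.
Qed.

Lemma scoth_le k x : 0 < k -> 0 < x -> scoth k x <= k + x^-1.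
Proof.
move=> k0 x0; rewrite ler_pdivrMr // mulrDl mulVf ?gt_eqF //.
by rewrite zcoth_le // mulr_gt0.
Qed.

Lemma is_derive_scoth k x : 0 < k -> 0 < x ->
  is_derive x (1 : R) (scoth k) (k ^+ 2 - scoth k x ^+ 2).
Proof.
move=> k0 x0; have kx0 : 0 < k * x by rewrite mulr_gt0.
apply: is_derive_eq (is_derive_div (is_derive_scaling (is_derive_zcoth kx0))
  (is_derive_idf x) (lt0r_neq0 x0)) _.
by rewrite /scoth; field; rewrite !gt_eqF.
Qed.

Lemma is_derive_scsch2 k x : 0 < k -> 0 < x ->
  is_derive x (1 : R) (scsch2 k) (- 2 * scoth k x * scsch2 k x).
Proof.
move=> k0 x0; have dc := is_derive_scoth k0 x0.
apply: is_derive_eq (is_deriveBf (is_deriveMf dc dc) (is_derive_const (k ^+ 2) x)) _.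
by rewrite /scsch2; ring.
Qed.

Lemma scsch2_chord k l m x : 0 < k -> k < l -> l <= m -> 0 < x ->
  (scoth k x * scsch2 k x - scoth l x * scsch2 l x) * (scsch2 l x - scsch2 m x) <=
  (scoth l x * scsch2 l x - scoth m x * scsch2 m x) * (scsch2 k x - scsch2 l x).
Proof.
move=> k0 kl lm x0.
have h := @zcoth_chord (k * x) (l * x) (m * x) _ _ _.
have {}h : (zcoth (k * x) * zcsch2 (k * x) - zcoth (l * x) * zcsch2 (l * x)) *
    (zcsch2 (l * x) - zcsch2 (m * x)) <=
  (zcoth (l * x) * zcsch2 (l * x) - zcoth (m * x) * zcsch2 (m * x)) *
    (zcsch2 (k * x) - zcsch2 (l * x)).
  by apply: h; rewrite ?mulr_gt0 // ?ltr_pM2r // ler_pM2r.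
have x5 : 0 < x ^- 5 by rewrite invr_gt0 exprn_gt0.
rewrite -(ler_pM2r x5) in h; move: h; rewrite !scsch2E // /scoth.
congr (_ <= _); field; exact: lt0r_neq0.
Qed.

(** The logarithmic derivative of sinh (l x) / sinh (k x). *)
Definition gap k l x : R := scoth l x - scoth k x.

Definition dgap k l x : R := scsch2 k x - scsch2 l x.

Lemma is_derive_gap k l x : 0 < k -> 0 < l -> 0 < x ->
  is_derive x (1 : R) (gap k l) (dgap k l x).
Proof.
move=> k0 l0 x0.
apply: is_derive_eq (is_deriveBf (is_derive_scoth l0 x0) (is_derive_scoth k0 x0)) _.
by rewrite /dgap /scsch2; ring.
Qed.

Lemma is_derive_dgap k l x : 0 < k -> 0 < l -> 0 < x ->
  is_derive x (1 : R) (dgap k l)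
    (- 2 * (scoth k x * scsch2 k x - scoth l x * scsch2 l x)).
Proof.
move=> k0 l0 x0.
apply: is_derive_eq (is_deriveBf (is_derive_scsch2 k0 x0) (is_derive_scsch2 l0 x0)) _.
by ring.
Qed.

Lemma gap_gt0 k l x : 0 < k -> k < l -> 0 < x -> 0 < gap k l x.
Proof.
move=> k0 kl x0; rewrite subr_gt0 ltr_pM2r ?invr_gt0 //.
by rewrite zcoth_incr ?mulr_gt0 // ltr_pM2r.
Qed.

Lemma dgap_gt0 k l x : 0 < k -> k < l -> 0 < x -> 0 < dgap k l x.
Proof. by move=> k0 kl x0; rewrite subr_gt0 scsch2_decr. Qed.

Lemma dgap_ge0 k l x : 0 < k -> k <= l -> 0 < x -> 0 <= dgap k l x.
Proof.
move=> k0; rewrite le_eqVlt => /orP[/eqP<- _|kl x0]; first by rewrite /dgap subrr.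
exact/ltW/dgap_gt0.
Qed.

Lemma gap_le k l x : 0 < k -> 0 < l -> 0 < x -> gap k l x <= l ^+ 2 * x.
Proof.
move=> k0 l0 x0; have kx0 : 0 < k * x by rewrite mulr_gt0.
have lx0 : 0 < l * x by rewrite mulr_gt0.
rewrite /gap /scoth -mulrBl ler_pdivrMr // -mulrA -expr2 -exprMn.
have := zcoth_gt1 kx0; have := zcoth_lt lx0; have := zcoth_gt1 lx0; lra.
Qed.

(** By the equation of [scsch2], the sign of the derivative of the ratio is the one
compared in [scsch2_chord], where the indices vary and x is fixed. *)
Lemma dgap_ratio_nincr k l m x y : 0 < k -> k < l -> l <= m -> 0 < x -> x <= y ->
  dgap l m y / dgap k l y <= dgap l m x / dgap k l x.
Proof.
move=> k0 kl lm x0 xy; have l0 := lt_trans k0 kl; have m0 := lt_le_trans l0 lm.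
have dn t : 0 < t -> dgap k l t != 0 by move=> t0; rewrite gt_eqF // dgap_gt0.
pose dF t := ((- 2 * (scoth l t * scsch2 l t - scoth m t * scsch2 m t)) * dgap k l t
  - dgap l m t * (- 2 * (scoth k t * scsch2 k t - scoth l t * scsch2 l t)))
   / dgap k l t ^+ 2.
have FdF (t : R) : 0 < t -> is_derive t (1 : R) (fun t => dgap l m t / dgap k l t) (dF t).
  move=> t0; apply: is_derive_div (dn _ t0); exact: is_derive_dgap.
apply: (nincr_pos FdF x0 xy) => t /andP[xt _]; have t0 := lt_trans x0 xt.
rewrite pmulr_lle0 ?invr_gt0 ?exprn_gt0 ?dgap_gt0 //.
have := scsch2_chord k0 kl lm t0; rewrite /dgap; lra.
Qed.

(** The Wronskian of [gap l m] and [gap k l], and just as well of [gap k m] and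
[gap k l]: the two differ by a Wronskian of [gap k l] with itself. *)
Definition wronskian k l m x : R :=
  gap l m x * dgap k l x - dgap l m x * gap k l x.

(** The Riccati equations give W' = - 2 (l coth (l x)) W + (a product of gaps), so
dividing by (l / sinh (l x))^2 removes the first term. *)
Lemma is_derive_wronskian_mid k l m x : 0 < k -> 0 < l -> 0 < m -> 0 < x ->
  is_derive x (1 : R) (fun t => wronskian k l m t / scsch2 l t)
   (2 * gap l m x * gap k l x * dgap k m x / scsch2 l x).
Proof.
move=> k0 l0 m0 x0.
have s0 : scsch2 l x != 0 by rewrite gt_eqF // scsch2_gt0.
apply: is_derive_eq (is_derive_div (is_deriveBf
  (is_deriveMf (is_derive_gap l0 m0 x0) (is_derive_dgap k0 l0 x0))
  (is_deriveMf (is_derive_dgap l0 m0 x0) (is_derive_gap k0 l0 x0)))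
  (is_derive_scsch2 l0 x0) s0) _.
move: s0; rewrite /wronskian /dgap /gap /scsch2 => s0; field; exact: s0.
Qed.

End Coth.

(** * Total positivity and Wronskians *)

Section TP2.
Context {R : realType}.
Implicit Types (x y z a b c d k l m : R).

Lemma dgapD a b c x : dgap a b x + dgap b c x = dgap a c x.
Proof. by rewrite /dgap; ring. Qed.

Lemma dgap_tp2_adjacent k l m x y : 0 < k -> k <= l -> l <= m -> 0 < x -> x <= y ->
  dgap l m y * dgap k l x <= dgap l m x * dgap k l y.
Proof.
move=> k0 kl lm x0 xy; have y0 := lt_le_trans x0 xy.
move: kl; rewrite le_eqVlt => /orP[/eqP<-|kl]; first by rewrite /dgap !subrr !mulr0.
rewrite -ler_pdivlMr ?dgap_gt0 // mulrAC -ler_pdivrMr ?dgap_gt0 //.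
exact: dgap_ratio_nincr.
Qed.

(** The general case follows from that of adjacent index intervals:
disjoint intervals are compared through the interval between them, overlapping
ones are split at their common part. *)
Lemma dgap_tp2 a b c d x y : 0 < a -> a <= b -> c <= d -> a <= c -> b <= d ->
  0 < x -> x <= y -> dgap c d y * dgap a b x <= dgap c d x * dgap a b y.
Proof.
move=> a0 ab cd ac bd x0 xy; have y0 := lt_le_trans x0 xy.
have b0 := lt_le_trans a0 ab; have c0 := lt_le_trans a0 ac.
have disjoint u v w t : a <= u -> u <= v -> v <= w -> w <= t ->
    dgap w t y * dgap u v x <= dgap w t x * dgap u v y.
  move=> au uv vw wt; have u0 := lt_le_trans a0 au; have v0 := lt_le_trans u0 uv.
  move: (vw); rewrite le_eqVlt => /orP[/eqP evw|vw'].
    by rewrite -evw in wt *; exact: dgap_tp2_adjacent.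
  have vwx := dgap_gt0 v0 vw' x0; have vwy := dgap_gt0 v0 vw' y0.
  have := dgap_tp2_adjacent u0 uv vw x0 xy; have := dgap_tp2_adjacent v0 vw wt x0 xy.
  have := dgap_ge0 u0 uv x0; have := dgap_ge0 (lt_le_trans v0 vw) wt x0.
  have := dgap_ge0 u0 uv y0.
  move: (dgap u v x) (dgap v w x) (dgap w t x) (dgap u v y) (dgap v w y) (dgap w t y) vwx vwy.
  move=> ux vx wx uy vy wy vx0 vy0 uy0 wx0 ux0 h1 h2.
  rewrite -(ler_pM2r vx0) -(ler_pM2r vy0).
  have := ler_wpM2r (mulr_ge0 ux0 (ltW vy0)) h1.
  have := ler_wpM2r (mulr_ge0 wx0 (ltW vy0)) h2.
  lra.
have [bc|cb] := leP b c; first exact: disjoint.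
have {}cb := ltW cb.
have h1 := disjoint a c c b (lexx a) ac (lexx c) cb.
have h2 := disjoint a c b d (lexx a) ac cb bd.
have h3 := disjoint c b b d ac cb (lexx b) bd.
rewrite -(dgapD a c b x) -(dgapD c b d x) -(dgapD a c b y) -(dgapD c b d y).
lra.
Qed.

Lemma dgap_ratio_mono a b c d x y : 0 < a -> a < b -> c <= d -> a <= c -> b <= d ->
  0 < x -> x <= y -> dgap c d y / dgap a b y <= dgap c d x / dgap a b x.
Proof.
move=> a0 ab cd ac bd x0 xy; have y0 := lt_le_trans x0 xy.
rewrite ler_pdivlMr ?dgap_gt0 // mulrAC ler_pdivrMr ?dgap_gt0 //.
by apply: dgap_tp2 => //; exact: ltW.
Qed.

Lemma scsch2_nincr k x y : 0 < k -> 0 < x -> x <= y -> scsch2 k y <= scsch2 k x.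
Proof.
move=> k0 x0 xy.
apply: (nincr_pos (fun t => is_derive_scsch2 k0) x0 xy) => t /andP[xt _].
have t0 := lt_trans x0 xt.
have := scoth_gt0 k0 t0; have := scsch2_gt0 k0 t0; nra.
Qed.

Lemma dgap_le k l x : 0 < k -> k <= l -> 0 < x -> dgap k l x <= l ^+ 2.
Proof.
move=> k0 kl x0; have l0 := lt_le_trans k0 kl.
suff : scoth k x <= scoth l x.
  have := scoth_gt0 k0 x0; rewrite /dgap /scsch2; nra.
move: kl; rewrite le_eqVlt => /orP[/eqP<-//|kl].
by rewrite -subr_ge0; apply/ltW/gap_gt0.
Qed.

(** The Wronskian vanishes at 0+, with the rate required by [gt0_of_derive] and
[ratio_nincr]. *)
Lemma wronskian_bound k l m x : 0 < k -> k < l -> l < m -> 0 < x < 1 ->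
  `|wronskian k l m x / scsch2 l x| <= m ^+ 2 * l ^+ 2 / scsch2 l 1 * x.
Proof.
move=> k0 kl lm /andP[x0 x1]; have l0 := lt_trans k0 kl; have m0 := lt_trans l0 lm.
have s0 := scsch2_gt0 l0 x0; have s10 := scsch2_gt0 l0 (@ltr01 R).
rewrite normrM [X in _ * X]ger0_norm ?invr_ge0; last exact: ltW.
rewrite mulrAC; apply: ler_pM => //; first by rewrite invr_ge0 ltW.
  rewrite ler_norml /wronskian.
  have := gap_gt0 l0 lm x0; have := gap_gt0 k0 kl x0.
  have := dgap_gt0 l0 lm x0; have := dgap_gt0 k0 kl x0.
  have := gap_le l0 m0 x0; have := gap_le k0 l0 x0.
  have := dgap_le k0 (ltW kl) x0; have := dgap_le l0 (ltW lm) x0.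
  have := exprn_gt0 2 l0; have := exprn_gt0 2 m0.
  move: (m ^+ 2) (l ^+ 2) (gap k l x) (gap l m x) (dgap k l x) (dgap l m x).
  move=> M L g h dg dh M0 L0 dhM dgL gL hM dg0 dh0 g0 h0.
  have A : dh * g <= M * L * x.
    by rewrite -mulrA; apply: ler_pM => //; exact: ltW.
  have B : h * dg <= M * L * x.
    by rewrite mulrAC; apply: ler_pM => //; exact: ltW.
  have := mulr_gt0 dh0 g0; have := mulr_gt0 h0 dg0; lra.
by rewrite lef_pV2 ?posrE // scsch2_nincr // ltW.
Qed.

Lemma wronskian_gt0 k l m x : 0 < k -> k < l -> l < m -> 0 < x -> 0 < wronskian k l m x.
Proof.
move=> k0 kl lm x0; have l0 := lt_trans k0 kl; have m0 := lt_trans l0 lm.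
suff : 0 < wronskian k l m x / scsch2 l x.
  by rewrite pmulr_lgt0 // invr_gt0 scsch2_gt0.
apply: (gt0_of_derive (k := m ^+ 2 * l ^+ 2 / scsch2 l 1)
    (fun t => is_derive_wronskian_mid k0 l0 m0) _ x0).
  by move=> t t01; have := wronskian_bound k0 kl lm t01; rewrite ler_norml => /andP[].
move=> t /andP[t0 _].
apply: divr_gt0; last exact: scsch2_gt0.
by rewrite !mulr_gt0 ?gap_gt0 // dgap_gt0 // (lt_trans kl).
Qed.

Lemma gap_ratio_ndecr k l m x y : 0 < k -> k < l -> l < m -> 0 < x -> x <= y ->
  gap k l x / gap l m x <= gap k l y / gap l m y.
Proof.
move=> k0 kl lm x0 xy; have l0 := lt_trans k0 kl; have m0 := lt_trans l0 lm.
have FdF (t : R) : 0 < t -> is_derive t (1 : R) (fun t => gap k l t / gap l m t)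
    (wronskian k l m t / gap l m t ^+ 2).
  move=> t0; have g0 : gap l m t != 0 by rewrite gt_eqF // gap_gt0.
  apply: is_derive_eq (is_derive_div (is_derive_gap k0 l0 t0) (is_derive_gap l0 m0 t0) g0) _.
  by congr (_ / _); rewrite /wronskian; ring.
apply: (ndecr_pos FdF x0 xy) => t /andP[xt _]; have t0 := lt_trans x0 xt.
by rewrite ltW // divr_gt0 ?exprn_gt0 ?gap_gt0 // wronskian_gt0.
Qed.

(** The same computation as in [is_derive_wronskian_mid], with the weight of the
lowest index.  Wronskians with the index 1 in the middle and those with 1 as the
lowest index can then be compared with the same weight. *)
Lemma is_derive_wronskian_low k l m x : 0 < k -> 0 < l -> 0 < m -> 0 < x ->
  is_derive x (1 : R) (fun t => wronskian k l m t / scsch2 k t)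
   (2 * gap k l x * gap k m x * dgap l m x / scsch2 k x).
Proof.
move=> k0 l0 m0 x0.
have s0 : scsch2 k x != 0 by rewrite gt_eqF // scsch2_gt0.
apply: is_derive_eq (is_derive_div (is_deriveBf
  (is_deriveMf (is_derive_gap l0 m0 x0) (is_derive_dgap k0 l0 x0))
  (is_deriveMf (is_derive_dgap l0 m0 x0) (is_derive_gap k0 l0 x0)))
  (is_derive_scsch2 k0 x0) s0) _.
move: s0; rewrite /wronskian /dgap /gap /scsch2 => s0; field; exact: s0.
Qed.

End TP2.

(** * The defect of two factors *)

Section Defect.
Context {R : realType}.
Variables (p rho sigma : R).
Hypothesis (p0 : 0 < p) (p1 : p < 1) (sigma1 : (1 : R) < sigma) (sr : sigma <= rho).
Implicit Types (x y t e k : R).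

Let rho1 : (1 : R) < rho. Proof. exact: lt_le_trans sr. Qed.
Let sigma0 : 0 < sigma. Proof. exact: lt_trans sigma1. Qed.
Let rho0 : 0 < rho. Proof. exact: lt_trans rho1. Qed.
Let one0 : 0 < 1 :> R. Proof. exact: ltr01. Qed.

(** For rho = r + 1 and sigma = s + 1 this is the logarithmic derivative H of
sinh (rho x) sinh (sigma x) / sinh^2 x. *)
Definition prod_slope x : R := gap 1 rho x + gap 1 sigma x.
Definition dprod_slope x : R := dgap 1 rho x + dgap 1 sigma x.
(** V, the Wronskian of H and j = [gap p 1]; see [wron_prodE]. *)
Definition wron_prod x : R := wronskian p 1 rho x + wronskian p 1 sigma x.
(** U, the Wronskian of the two terms of H; see [wron_pairE]. *)
Definition wron_pair x : R := wronskian 1 sigma rho x.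

Lemma prod_slope_gt0 x : 0 < x -> 0 < prod_slope x.
Proof. by move=> x0; rewrite addr_gt0 ?gap_gt0. Qed.

Lemma dprod_slope_gt0 x : 0 < x -> 0 < dprod_slope x.
Proof. by move=> x0; rewrite addr_gt0 ?dgap_gt0. Qed.

Lemma is_derive_prod_slope x : 0 < x -> is_derive x (1 : R) prod_slope (dprod_slope x).
Proof. by move=> x0; apply: is_deriveDf; exact: is_derive_gap. Qed.

Lemma wron_prod_gt0 x : 0 < x -> 0 < wron_prod x.
Proof. by move=> x0; rewrite addr_gt0 ?wronskian_gt0. Qed.

Lemma wron_prodE x : wron_prod x = prod_slope x * dgap p 1 x - dprod_slope x * gap p 1 x.
Proof. by rewrite /wron_prod /wronskian /prod_slope /dprod_slope; ring. Qed.

Lemma wron_pair_ge0 x : 0 < x -> 0 <= wron_pair x.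
Proof.
move: sr; rewrite le_eqVlt => /orP[/eqP e|lt] x0.
  by rewrite /wron_pair /wronskian -e /gap /dgap !subrr !mul0r subrr.
exact/ltW/wronskian_gt0.
Qed.

Lemma wron_pairE x : wron_pair x = gap 1 rho x * dgap 1 sigma x - dgap 1 rho x * gap 1 sigma x.
Proof. by rewrite /wron_pair /wronskian /gap /dgap; ring. Qed.

(** U and V multiplied by sinh^2 vanish at 0, and the ratio of their
derivatives is, with al = [gap 1 rho], be = [gap 1 sigma] and j = [gap p 1],
  (1 - be'/al') / ((j/be) (1 + j'/al') + (j/al) (be'/al' + j'/al')),
in which be'/al', j'/al', j/al and j/be are all nondecreasing. *)
Lemma wron_ratio_nincr x y : 0 < x -> x <= y ->
  wron_pair y / wron_prod y <= wron_pair x / wron_prod x.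
Proof.
move=> x0 xy; have y0 := lt_le_trans x0 xy.
pose c t : R := scsch2 1 t.
have c0 t : 0 < t -> 0 < c t by move=> t0; exact: scsch2_gt0.
have cn0 t : 0 < t -> c t != 0 by move=> /c0 /gt_eqF ->.
have key t : 0 < t -> wron_pair t / wron_prod t = (wron_pair t / c t) / (wron_prod t / c t).
  move=> t0; have := wron_prod_gt0 t0 => /gt_eqF/negbT Vn0.
  by field; rewrite Vn0 cn0.
rewrite !key //.
pose dU t := 2 * gap 1 sigma t * gap 1 rho t * dgap sigma rho t / c t.
pose dV t := 2 * gap 1 rho t * gap p 1 t * dgap p rho t / c t +
   2 * gap 1 sigma t * gap p 1 t * dgap p sigma t / c t.
have psigma := lt_trans p1 sigma1; have prho := lt_trans p1 rho1.
pose ks : R := rho ^+ 2 * 1 ^+ 2 / c 1 + sigma ^+ 2 * 1 ^+ 2 / c 1.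
have UdU (t : R) : 0 < t -> is_derive t (1 : R) (fun t => wron_pair t / c t) (dU t).
  by move=> t0; exact: is_derive_wronskian_low.
have VdV (t : R) : 0 < t -> is_derive t (1 : R) (fun t => wron_prod t / c t) (dV t).
  move=> t0; have -> : (fun t => wron_prod t / c t) =
      (fun t => wronskian p 1 rho t / c t + wronskian p 1 sigma t / c t).
    by apply/funext => u; rewrite /wron_prod mulrDl.
  exact: is_deriveDf (is_derive_wronskian_mid p0 one0 rho0 t0)
    (is_derive_wronskian_mid p0 one0 sigma0 t0).
have dU0 t : 0 < t -> 0 <= dU t.
  move=> t0; apply: divr_ge0; last exact/ltW/c0.
  by rewrite mulr_ge0 ?dgap_ge0 // ltW // !mulr_gt0 ?gap_gt0.
have dV0 t : 0 < t -> 0 < dV t.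
  move=> t0; apply: addr_gt0; apply: divr_gt0; try exact: c0.
    by rewrite !mulr_gt0 ?gap_gt0 ?dgap_gt0.
  by rewrite !mulr_gt0 ?gap_gt0 ?dgap_gt0.
have ks0 t : 0 < t < 1 -> - (ks * t) <= wron_pair t / c t.
  move=> /andP[t0 t1]; apply: (@le_trans _ _ 0); last first.
    by rewrite divr_ge0 ?wron_pair_ge0 // ltW // c0.
  rewrite oppr_le0 mulr_ge0 // ?ltW // /ks.
  by rewrite addr_gt0 // divr_gt0 ?c0 // expr1n mulr1 exprn_gt0.
have kV t : 0 < t < 1 -> wron_prod t / c t <= ks * t.
  move=> t01; rewrite /wron_prod /ks [leLHS]mulrDl [leRHS]mulrDl; apply: lerD.
    exact: le_trans (ler_norm _) (wronskian_bound p0 p1 rho1 t01).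
  exact: le_trans (ler_norm _) (wronskian_bound p0 p1 sigma1 t01).
apply: (ratio_nincr UdU VdV ks0 kV _ dV0 dU0 _ x0 xy).
  by move=> t t0; rewrite divr_gt0 ?wron_prod_gt0 // c0.
move=> s t s0 st; have t0 := lt_le_trans s0 st.
have dUVE u : 0 < u -> dU u / dV u = (dgap sigma rho u / dgap 1 rho u) /
   ((gap p 1 u / gap 1 sigma u) * (dgap p rho u / dgap 1 rho u) +
    (gap p 1 u / gap 1 rho u) * (dgap p sigma u / dgap 1 rho u)).
  move=> u0; have j0 := gap_gt0 p0 p1 u0.
  have a0 := gap_gt0 one0 rho1 u0; have b0 := gap_gt0 one0 sigma1 u0.
  have da0 := dgap_gt0 one0 rho1 u0.
  have dpr := dgap_gt0 p0 prho u0; have dps := dgap_gt0 p0 psigma u0.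
  have := c0 u u0; rewrite /dU /dV.
  move: (gap p 1 u) (gap 1 rho u) (gap 1 sigma u) (dgap 1 rho u) (dgap p rho u)
    (dgap p sigma u) (dgap sigma rho u) (c u) j0 a0 b0 da0 dpr dps
    => j a b da dp ds dsr cu j0 a0 b0 da0 dp0 ds0 cu0.
  have e1 : 0 < j * dp * a + j * ds * b by rewrite addr_gt0 // !mulr_gt0.
  have e2 : 0 < 2 * a * j * dp + 2 * b * j * ds by rewrite addr_gt0 // !mulr_gt0.
  by field; rewrite !gt_eqF.
rewrite !dUVE //.
pose top u := dgap sigma rho u / dgap 1 rho u.
have top0 u : 0 < u -> 0 <= top u.
  by move=> u0; rewrite divr_ge0 ?dgap_ge0 // ltW // dgap_gt0.
have q0 k l u : 0 < k -> k < l -> 0 < u -> 0 < dgap k l u / dgap 1 rho u.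
  by move=> k0 kl u0; rewrite divr_gt0 ?dgap_gt0.
have g0 l u : 1 < l -> 0 < u -> 0 < gap p 1 u / gap 1 l u.
  by move=> l1 u0; rewrite divr_gt0 ?gap_gt0.
have qm k l : 0 < k -> k <= 1 -> k < l -> l <= rho ->
    dgap k l s / dgap 1 rho s <= dgap k l t / dgap 1 rho t.
  move=> k0 k1 kl lr.
  rewrite ler_pdivrMr ?dgap_gt0 // mulrAC ler_pdivlMr ?dgap_gt0 //.
  have := @dgap_tp2 R k l 1 rho s t k0 (ltW kl) (ltW rho1) k1 lr s0 st.
  by rewrite [X in X <= _ -> _]mulrC [X in _ <= X -> _]mulrC.
apply: ler_pM.
- exact: top0.
- by rewrite invr_ge0 addr_ge0 //; apply/ltW/mulr_gt0;
     [exact: g0|exact: q0|exact: g0|exact: q0].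
- by apply: dgap_ratio_mono => //; exact: ltW.
rewrite lef_pV2 ?posrE; last 2 first.
- by apply: addr_gt0; apply: mulr_gt0; first [exact: g0|exact: q0].
- by apply: addr_gt0; apply: mulr_gt0; first [exact: g0|exact: q0].
apply: lerD; apply: ler_pM.
- exact/ltW/g0.
- exact/ltW/q0.
- exact: gap_ratio_ndecr.
- by apply: qm => //; exact: ltW.
- exact/ltW/g0.
- exact/ltW/q0.
- exact: gap_ratio_ndecr.
- by apply: qm => //; exact: ltW.
Qed.

(** V / H' = H (j'/H') - j.  When x increases to y, the growth of j is at most
(j'/H')(y) times that of H, as j'/H' is nondecreasing; so V / H' is
nondecreasing as well. *)
Lemma dprod_slope_ratio_nincr x y : 0 < x -> x <= y ->
  dprod_slope y / wron_prod y <= dprod_slope x / wron_prod x.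
Proof.
move=> x0 xy; have y0 := lt_le_trans x0 xy.
pose e := dgap p 1 y / dprod_slope y.
have ke t : 0 < t -> t <= y -> dgap p 1 t <= e * dprod_slope t.
  move=> t0 ty; rewrite mulrAC ler_pdivlMr ?dprod_slope_gt0 //.
  rewrite /dprod_slope [leLHS]mulrDr [leRHS]mulrDr.
  have le1l l : 1 < l -> dgap p 1 t * dgap 1 l y <= dgap p 1 y * dgap 1 l t.
    move=> l1; rewrite [leLHS]mulrC [leRHS]mulrC.
    by apply: dgap_tp2 => //; exact: ltW.
  by apply: lerD; exact: le1l.
pose F t := gap p 1 t - e * prod_slope t.
pose dF t := dgap p 1 t - e * dprod_slope t.
have FdF (t : R) : 0 < t -> is_derive t (1 : R) F (dF t).
  move=> t0; apply: is_derive_eq (is_deriveBf (is_derive_gap p0 one0 t0)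
    (is_deriveMf (is_derive_const e t) (is_derive_prod_slope t0))) _.
  by rewrite mul0r add0r.
have Fyx : F y <= F x.
  apply: (nincr_pos FdF x0 xy) => t /andP[xt ty].
  by rewrite subr_le0 ke ?(lt_trans x0) // ltW.
have Vy := wron_prod_gt0 y0; have Vx := wron_prod_gt0 x0.
have dHy := dprod_slope_gt0 y0; have dHx := dprod_slope_gt0 x0.
rewrite ler_pdivrMr // mulrAC ler_pdivlMr // mulrC [leRHS]mulrC.
rewrite !wron_prodE; move: Fyx (ke x x0 xy) (prod_slope_gt0 x0); rewrite /F.
have ey : dgap p 1 y = e * dprod_slope y by rewrite /e divfK // gt_eqF.
rewrite ey => Fyx kx Hx0.
have h1 := ler_wpM2r (mulr_ge0 (ltW dHx) (ltW dHy)) Fyx.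
have h2 := ler_wpM2r (mulr_ge0 (ltW Hx0) (ltW dHy)) kx.
lra.
Qed.

Lemma prod_slopeV_nincr x y : 0 < x -> x <= y -> (prod_slope y)^-1 <= (prod_slope x)^-1.
Proof.
move=> x0 xy; have y0 := lt_le_trans x0 xy.
rewrite lef_pV2 ?posrE ?prod_slope_gt0 //.
apply: (ndecr_pos is_derive_prod_slope x0 xy) => t /andP[xt _].
exact/ltW/dprod_slope_gt0/(lt_trans x0).
Qed.

(** The relative difference of the two terms of H, which decreases as the smaller
index catches up. *)
Definition imbalance x : R := (gap 1 rho x - gap 1 sigma x) / prod_slope x.

Lemma is_derive_imbalance x : 0 < x ->
  is_derive x (1 : R) imbalance (- (2 * wron_pair x / prod_slope x ^+ 2)).
Proof.
move=> x0; have Hn0 : prod_slope x != 0 by rewrite gt_eqF ?prod_slope_gt0.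
apply: is_derive_eq (is_derive_div (is_deriveBf (is_derive_gap one0 rho0 x0)
  (is_derive_gap one0 sigma0 x0)) (is_derive_prod_slope x0) Hn0) _.
by rewrite wron_pairE; move: Hn0; rewrite /prod_slope /dprod_slope => Hn0; field.
Qed.

Lemma imbalance_nincr x y : 0 < x -> x <= y -> imbalance y <= imbalance x.
Proof.
move=> x0 xy; apply: (nincr_pos is_derive_imbalance x0 xy) => t /andP[xt _].
have t0 := lt_trans x0 xt.
rewrite oppr_le0; apply: divr_ge0; last by rewrite exprn_ge0 // ltW // prod_slope_gt0.
by apply: mulr_ge0 => //; exact: wron_pair_ge0.
Qed.

Lemma imbalance_ge0 x : 0 < x -> 0 <= imbalance x.
Proof.
move=> x0; apply: divr_ge0; last exact/ltW/prod_slope_gt0.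
move: sr; rewrite le_eqVlt => /orP[/eqP e|lt]; first by rewrite e subrr.
by have := gap_gt0 sigma0 lt x0; rewrite /gap; lra.
Qed.

(** r + s + 1 in terms of rho = r + 1 and sigma = s + 1. *)
Definition top_index : R := rho + sigma - 1.
(** p n (n+2) - r(r+2) - s(s+2), which is nonnegative exactly for p >= b; see
[b_rs_le]. *)
Definition excess : R := p * (top_index ^+ 2 - 1) - (rho ^+ 2 + sigma ^+ 2 - 2).

(** Y: up to a positive factor, the derivative of the slope of the defect at a point
where that slope vanishes. *)
Definition slope_rate x : R := excess - p * prod_slope x ^+ 2
  + (gap 1 rho x ^+ 2 + gap 1 sigma x ^+ 2)
  + 2 * gap p 1 x * prod_slope x.

(** The derivative of Y / H^2 without its positive factor 2 / H^2. *)
Definition rate_num x : R :=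
  wron_prod x - excess * dprod_slope x / prod_slope x - imbalance x * wron_pair x.

Lemma is_derive_rate_ratio x : 0 < x ->
  is_derive x (1 : R) (fun t => slope_rate t / prod_slope t ^+ 2)
   (2 * rate_num x / prod_slope x ^+ 2).
Proof.
move=> x0; have Hn0 : prod_slope x != 0 by rewrite gt_eqF ?prod_slope_gt0.
have dr := is_derive_gap one0 rho0 x0; have ds := is_derive_gap one0 sigma0 x0.
have dj := is_derive_gap p0 one0 x0; have dh := is_derive_prod_slope x0.
have H2n0 : prod_slope x * prod_slope x != 0 by rewrite mulf_neq0.
apply: is_derive_eq (is_derive_div (is_deriveDf (is_deriveDf (is_deriveBf
  (is_derive_const excess x) (is_deriveMf (is_derive_const p x) (is_deriveMf dh dh)))
  (is_deriveDf (is_deriveMf dr dr) (is_deriveMf ds ds)))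
  (is_deriveMf (is_deriveMf (is_derive_const 2 x) dj) dh))
  (is_deriveMf dh dh) H2n0) _.
rewrite /rate_num /imbalance wron_prodE wron_pairE.
move: (excess) Hn0; rewrite /prod_slope /dprod_slope => c Hn0.
by field.
Qed.

(** Divided by V, this is 1 minus two products of nonnegative nonincreasing
functions. *)
Lemma rate_num_gt0 x y : 0 <= excess -> 0 < x -> x <= y -> 0 < rate_num x -> 0 < rate_num y.
Proof.
move=> C0 x0 xy; have y0 := lt_le_trans x0 xy.
have KE t : 0 < t -> rate_num t =
    wron_prod t * (1 - excess * ((prod_slope t)^-1 * (dprod_slope t / wron_prod t))
      - imbalance t * (wron_pair t / wron_prod t)).
  move=> t0; have Hn0 : prod_slope t != 0 by rewrite gt_eqF ?prod_slope_gt0.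
  have Vn0 : wron_prod t != 0 by rewrite gt_eqF ?wron_prod_gt0.
  by rewrite /rate_num; field; rewrite ?Hn0 ?Vn0.
rewrite !KE // !pmulr_rgt0 ?wron_prod_gt0 // => /lt_le_trans; apply.
have V0 t : 0 < t -> 0 <= (wron_prod t)^-1 by move=> t0; rewrite invr_ge0 ltW ?wron_prod_gt0.
apply: lerB; last first.
  by apply: ler_pM; rewrite ?imbalance_ge0 ?imbalance_nincr
     ?wron_ratio_nincr ?mulr_ge0 ?V0 ?wron_pair_ge0.
rewrite lerD2l lerN2 ler_wpM2l //; apply: ler_pM.
- by rewrite invr_ge0 ltW ?prod_slope_gt0.
- by rewrite mulr_ge0 ?V0 // ltW // dprod_slope_gt0.
- exact: prod_slopeV_nincr.
- exact: dprod_slope_ratio_nincr.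
Qed.

(** At infinity every k coth (k x) tends to k, and Y to
C - p n^2 + r^2 + s^2 + 2 (1 - p) n = 0.  The error k coth (k x) - k is at most
1/x, so Y is at most a constant times 1/x. *)
Lemma slope_rate_small e : 0 < e -> exists2 X, 0 < X & forall x, X <= x -> slope_rate x <= e.
Proof.
move=> e0; pose n : R := rho + sigma - 2.
have sg1 := sigma1; have rh1 := rho1; have pp0 := p0; have pp1 := p1.
have n0 : 0 < n by rewrite /n; lra.
have k0 : 0 < 8 * n + 10 by lra.
exists (1 + (8 * n + 10) / e) => [|x Xx]; first by rewrite addr_gt0 // divr_gt0.
have x0 : 0 < x by apply: lt_le_trans Xx; rewrite addr_gt0 // divr_gt0.
have x1 : 1 <= x by apply: le_trans Xx; rewrite lerDl divr_ge0 // ltW.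
pose ep : R := x^-1.
have ep0 : 0 < ep by rewrite invr_gt0.
have ep1 : ep <= 1 by rewrite invf_le1.
have epe : (8 * n + 10) * ep <= e.
  rewrite ler_pdivrMr // -ler_pdivrMl // mulrC; apply: le_trans Xx.
  by rewrite lerDr.
apply: le_trans epe.
have hr := scoth_le rho0 x0; have hs := scoth_le sigma0 x0.
have h1 := scoth_le one0 x0; have hp := scoth_le p0 x0.
have gr := scoth_gt rho0 x0; have gs := scoth_gt sigma0 x0.
have g1 := scoth_gt one0 x0; have gp := scoth_gt p0 x0.
pose u : R := gap 1 rho x - (rho - 1); pose v : R := gap 1 sigma x - (sigma - 1).
pose w : R := gap p 1 x - (1 - p).
have -> : slope_rate x = 2 * ((rho - 1) * u) + 2 * ((sigma - 1) * v) + u * u + v * v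
    - 2 * (p * n * (u + v)) - p * (u + v) ^+ 2 + 2 * ((1 - p) * (u + v))
    + 2 * (n * w) + 2 * (w * u) + 2 * (w * v).
  by rewrite /slope_rate /excess /top_index /prod_slope /u /v /w /n; ring.
have u1 : `|u| <= ep by rewrite ler_norml /u /gap /ep; lra.
have v1 : `|v| <= ep by rewrite ler_norml /v /gap /ep; lra.
have w1 : `|w| <= ep by rewrite ler_norml /w /gap /ep; lra.
have prod (a b : R) : `|a| <= ep -> `|b| <= ep -> a * b <= ep.
  move=> a1 b1; apply: le_trans (ler_norm _) _; rewrite normrM.
  apply: le_trans (ler_pM _ _ a1 b1) _ => //.
  by rewrite ler_piMr // ltW.
have uu := prod _ _ u1 u1; have vv := prod _ _ v1 v1.
have wu := prod _ _ w1 u1; have wv := prod _ _ w1 v1.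
move: u1 v1 w1; rewrite !ler_norml => /andP[u2 u1] /andP[v2 v1] /andP[w2 w1].
have ru : (rho - 1) * u <= (rho - 1) * ep by apply: ler_wpM2l => //; lra.
have sv : (sigma - 1) * v <= (sigma - 1) * ep by apply: ler_wpM2l => //; lra.
have nw : n * w <= n * ep by apply: ler_wpM2l => //; exact: ltW.
have puv : - (p * n * (u + v)) <= n * (2 * ep).
  have : p * n * (- (u + v)) <= p * n * (2 * ep).
    by apply: ler_wpM2l; [rewrite mulr_ge0 // ltW|lra].
  have : p * (n * (2 * ep)) <= 1 * (n * (2 * ep)).
    by apply: ler_wpM2r; [rewrite !mulr_ge0 // ltW|exact: ltW].
  by rewrite mulrN !mulrA mul1r; lra.
have quv : (1 - p) * (u + v) <= 2 * ep.
  have : (1 - p) * (u + v) <= (1 - p) * (2 * ep) by apply: ler_wpM2l; lra.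
  have : 0 <= p * ep by rewrite mulr_ge0 // ltW.
  lra.
have sq : 0 <= p * (u + v) ^+ 2 by rewrite mulr_ge0 ?sqr_ge0 // ltW.
have rs : (rho - 1) * ep + (sigma - 1) * ep = n * ep by rewrite /n; ring.
lra.
Qed.

(** If Y x < 0 <= Y y, then Y / H^2 increases somewhere between x and y, hence
strictly from there on; so it is positive beyond y and stays away from its
limit 0. *)
Lemma slope_rate_lt0 x y : 0 <= excess -> 0 < x -> x < y ->
  slope_rate x < 0 -> slope_rate y < 0.
Proof.
move=> C0 x0 xy Yx; rewrite ltNge; apply/negP => Yy.
have y0 := lt_trans x0 xy.
pose F t := slope_rate t / prod_slope t ^+ 2.
have H2 t : 0 < t -> 0 < prod_slope t ^+ 2 by move=> t0; rewrite exprn_gt0 // prod_slope_gt0.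
have Fx : F x < 0 by rewrite /F pmulr_llt0 // invr_gt0 H2.
have Fy : 0 <= F y by rewrite /F divr_ge0 // ltW // H2.
have [t /andP[xt ty] e] := MVT_pos is_derive_rate_ratio x0 xy.
have t0 := lt_trans x0 xt.
have yx : 0 < y - x by rewrite subr_gt0.
have Kt : 0 < rate_num t.
  have : 0 < 2 * rate_num t / prod_slope t ^+ 2 * (y - x).
    by rewrite -e subr_gt0 (lt_le_trans Fx).
  by rewrite pmulr_lgt0 // pmulr_lgt0 ?invr_gt0 ?H2 // pmulr_rgt0.
have Fincr a b : t < a -> a < b -> F a < F b.
  move=> ta ab; have a0 := lt_trans t0 ta.
  apply: (incr_pos is_derive_rate_ratio a0 ab) => u /andP[au _].
  have tu := lt_trans ta au.
  apply: divr_gt0; last exact/H2/(lt_trans t0 tu).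
  by rewrite mulr_gt0 // (rate_num_gt0 C0 t0 (ltW tu)).
have yy1 : y < y + 1 by rewrite ltrDl.
have d0 : 0 < F (y + 1) by apply: le_lt_trans Fy _; exact: Fincr.
have y10 := lt_trans y0 yy1.
have e0 : 0 < F (y + 1) * prod_slope (y + 1) ^+ 2 / 2 by rewrite divr_gt0 // mulr_gt0 // H2.
have [X X0 hX] := slope_rate_small e0.
pose z : R := X + (y + 2).
have yz : y + 1 < z by rewrite /z; lra.
have z0 := lt_trans y10 yz.
have Xz : X <= z by rewrite /z; lra.
have := hX _ Xz.
have FYz : slope_rate z = F z * prod_slope z ^+ 2 by rewrite /F divfK // gt_eqF ?H2.
have : F (y + 1) * prod_slope (y + 1) ^+ 2 <= F z * prod_slope z ^+ 2.
  apply: ler_pM => //; [exact: ltW|exact/ltW/H2| |].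
    by apply/ltW/Fincr => //; exact: lt_trans yy1.
  rewrite ler_pXn2r ?nnegrE ?(ltW (prod_slope_gt0 _)) //.
  apply: (ndecr_pos is_derive_prod_slope y10 (ltW yz)) => u /andP[yu _].
  exact/ltW/dprod_slope_gt0/(lt_trans y10).
rewrite -FYz; lra.
Qed.

Definition lsinh k x : R := ln (sinh (k * x)).

Lemma is_derive_lsinh k x : 0 < k -> 0 < x -> is_derive x (1 : R) (lsinh k) (scoth k x).
Proof.
move=> k0 x0; have kx0 : 0 < k * x by rewrite mulr_gt0.
have ds := is_derive_scaling (is_derive_sinh (k * x)).
have dl := @is_derive1_comp R (@ln R) (fun t => sinh (k * t)) x _ _
  (is_derive1_ln (sinh_gt0 kx0)) ds.
apply: is_derive_eq dl _.
rewrite /scoth /zcoth; field.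
by rewrite !gt_eqF // sinh_gt0.
Qed.

Lemma top_index_gt1 : (1 : R) < top_index.
Proof. by rewrite /top_index; have := rho1; have := sigma1; lra. Qed.

Let Np0 : 0 < top_index * p. Proof. by rewrite mulr_gt0 // (lt_trans ltr01 top_index_gt1). Qed.
Let pNp : p < top_index * p. Proof. by rewrite ltr_pMl // top_index_gt1. Qed.

(** The derivative of the defect; [gap p (top_index * p)] is the derivative of
h_(r+s)(px). *)
Definition defect_slope x : R := gap p (top_index * p) x - p * prod_slope x.

(** The logarithm of the integrating factor: the slope D' of the defect satisfies
D'' = p Y - D' (M coth (M x) + p coth (p x) + p H) with M = p (r + s + 1), and the
parenthesis is the derivative of this function. *)
Definition log_weight x : R := lsinh (top_index * p) x + lsinh p x
  + p * (lsinh rho x + lsinh sigma x - 2 * lsinh 1 x).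

Lemma is_derive_lsinh_combination x : 0 < x -> is_derive x (1 : R)
  (fun t => p * (lsinh rho t + lsinh sigma t - 2 * lsinh 1 t)) (p * prod_slope x).
Proof.
move=> x0; apply: is_derive_eq (is_deriveMf (is_derive_const p x)
  (is_deriveBf (is_deriveDf (is_derive_lsinh rho0 x0) (is_derive_lsinh sigma0 x0))
    (is_deriveMf (is_derive_const 2 x) (is_derive_lsinh one0 x0)))) _.
by rewrite /prod_slope /gap; ring.
Qed.

Lemma is_derive_log_weight x : 0 < x ->
  is_derive x (1 : R) log_weight (scoth (top_index * p) x + scoth p x + p * prod_slope x).
Proof.
move=> x0; exact: (is_deriveDf (is_deriveDf (is_derive_lsinh Np0 x0)
  (is_derive_lsinh p0 x0)) (is_derive_lsinh_combination x0)).
Qed.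

Definition weighted_slope x : R := defect_slope x * expR (log_weight x).

Lemma is_derive_weighted_slope x : 0 < x ->
  is_derive x (1 : R) weighted_slope (p * slope_rate x * expR (log_weight x)).
Proof.
move=> x0.
have dE := is_deriveBf (is_derive_gap p0 Np0 x0)
  (is_deriveMf (is_derive_const p x) (is_derive_prod_slope x0)).
have dI := @is_derive1_comp R (@expR R) log_weight x _ _
  (is_derive_expR (log_weight x)) (is_derive_log_weight x0).
apply: is_derive_eq (is_deriveMf dE dI) _.
rewrite /= /slope_rate /excess /prod_slope /dprod_slope /dgap /scsch2 /gap; ring.
Qed.

Lemma log_weight_le t : 0 < t < 1 -> expR (log_weight t) <= expR (log_weight 1).
Proof.
move=> /andP[t0 t1]; rewrite ler_expR.
apply: (ndecr_pos is_derive_log_weight t0 (ltW t1)) => u /andP[tu _].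
have u0 := lt_trans t0 tu.
by rewrite ltW // !addr_gt0 ?scoth_gt0 // mulr_gt0 // prod_slope_gt0.
Qed.

Lemma prod_slope_le t : 0 < t -> prod_slope t <= (rho ^+ 2 + sigma ^+ 2) * t.
Proof. by move=> t0; rewrite [leRHS]mulrDl; apply: lerD; exact: gap_le. Qed.

Lemma weighted_slope_bound t : 0 < t < 1 -> `|weighted_slope t| <=
  ((top_index * p) ^+ 2 + p * (rho ^+ 2 + sigma ^+ 2)) * expR (log_weight 1) * t.
Proof.
move=> t01; have /andP[t0 t1] := t01.
rewrite normrM [X in _ * X]ger0_norm ?expR_ge0 // mulrAC.
apply: (ler_pM (normr_ge0 _) (expR_ge0 _) _ (log_weight_le t01)).
have g0 := gap_gt0 p0 pNp t0; have gle := gap_le p0 Np0 t0.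
have pH0 : 0 < p * prod_slope t by rewrite mulr_gt0 // prod_slope_gt0.
have pHle : p * prod_slope t <= p * ((rho ^+ 2 + sigma ^+ 2) * t).
  by rewrite ler_pM2l // prod_slope_le.
have a0 : 0 < (top_index * p) ^+ 2 * t by rewrite mulr_gt0 // exprn_gt0.
have -> : ((top_index * p) ^+ 2 + p * (rho ^+ 2 + sigma ^+ 2)) * t =
    (top_index * p) ^+ 2 * t + p * ((rho ^+ 2 + sigma ^+ 2) * t) by ring.
by rewrite ler_norml /defect_slope; lra.
Qed.

Lemma defect_slope_lt0 x y : 0 <= excess -> 0 < x -> x < y ->
  defect_slope x < 0 -> defect_slope y < 0.
Proof.
move=> C0 x0 xy Ex.
have ei t : (weighted_slope t < 0) = (defect_slope t < 0).
  by rewrite /weighted_slope (pmulr_llt0 _ (expR_gt0 _)).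
have sgn t : (p * slope_rate t * expR (log_weight t) < 0) = (slope_rate t < 0).
  by rewrite (pmulr_llt0 _ (expR_gt0 _)) (pmulr_rlt0 _ p0).
rewrite -ei; apply: (@le_lt_trans _ _ (weighted_slope x)); last by rewrite ei.
have [t /andP[t0 tx]] := neg_derive_before is_derive_weighted_slope
  (fun t t01 => proj1 (andP (etrans (esym (ler_norml _ _)) (weighted_slope_bound t01)))) x0
  (etrans (ei x) Ex).
rewrite sgn => Yt.
apply: (nincr_pos is_derive_weighted_slope x0 (ltW xy)) => u /andP[xu _].
by apply/ltW; rewrite sgn (slope_rate_lt0 C0 t0 (lt_trans tx xu)).
Qed.

Definition defect x : R := lsinh (top_index * p) x - lsinh p x
  - p * (lsinh rho x + lsinh sigma x - 2 * lsinh 1 x).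

Lemma is_derive_defect x : 0 < x -> is_derive x (1 : R) defect (defect_slope x).
Proof.
move=> x0; exact: (is_deriveBf (is_deriveBf (is_derive_lsinh Np0 x0)
  (is_derive_lsinh p0 x0)) (is_derive_lsinh_combination x0)).
Qed.

Lemma defect_nincr k x y : 0 <= excess -> (forall t, 0 < t < 1 -> - (k * t) <= defect t) ->
  0 < x -> defect x < 0 -> x <= y -> defect y <= defect x.
Proof.
move=> C0 kD x0 Dx xy.
have [t /andP[t0 tx] Et] := neg_derive_before is_derive_defect kD x0 Dx.
apply: (nincr_pos is_derive_defect x0 xy) => u /andP[xu _].
exact/ltW/(defect_slope_lt0 C0 t0 (lt_trans tx xu)).
Qed.

(** As x -> 0, Y tends to C; if C < 0 then Y is negative near 0, and so are the slope
and the defect, which both vanish at 0. *)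
Lemma defect_lt0_near0 k : excess < 0 -> (forall t, 0 < t < 1 -> defect t <= k * t) ->
  exists2 x, 0 < x & defect x < 0.
Proof.
move=> C0 kD.
pose h : R := rho ^+ 2 + sigma ^+ 2.
have h0 : 0 < h by rewrite addr_gt0 // exprn_gt0.
have d0 : 0 < h ^+ 2 + 2 * h + 1 by rewrite !addr_gt0 // ?exprn_gt0 // mulr_gt0.
pose x : R := Num.min (1 / 2) (- excess / (h ^+ 2 + 2 * h + 1)).
have x0 : 0 < x by rewrite lt_min !divr_gt0 // oppr_gt0.
have Yx t : 0 < t < x -> slope_rate t < 0.
  move=> /andP[t0]; rewrite lt_min => /andP[t1]; rewrite ltr_pdivlMr // => tC.
  have {}t1 : t < 1 by lra.
  have Ht := prod_slope_le t0; have H0 := prod_slope_gt0 t0.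
  have g0 := gap_gt0 p0 p1 t0; have := gap_le p0 one0 t0; rewrite expr1n mul1r => gt'.
  have a0 := gap_gt0 one0 rho1 t0; have b0 := gap_gt0 one0 sigma1 t0.
  have ab : gap 1 rho t ^+ 2 + gap 1 sigma t ^+ 2 <= prod_slope t ^+ 2.
    have -> : prod_slope t ^+ 2 = gap 1 rho t ^+ 2 + gap 1 sigma t ^+ 2
        + 2 * (gap 1 rho t * gap 1 sigma t) by rewrite /prod_slope; ring.
    by rewrite lerDl ltW // !mulr_gt0.
  have H2 : prod_slope t ^+ 2 <= h ^+ 2 * t.
    apply: (@le_trans _ _ ((h * t) ^+ 2)).
      by rewrite ler_pXn2r ?nnegrE ?mulr_ge0 // ltW.
    by rewrite exprMn ler_pM2l ?exprn_gt0 // expr2 ler_piMr // ltW.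
  have gH : gap p 1 t * prod_slope t <= h * t.
    have : gap p 1 t * prod_slope t <= 1 * prod_slope t.
      by rewrite ler_pM2r // (le_trans gt') // ltW.
    by rewrite mul1r => /le_trans; apply.
  have pH : 0 <= p * prod_slope t ^+ 2 by rewrite mulr_ge0 ?sqr_ge0 // ltW.
  rewrite /slope_rate -[_ * gap p 1 t * _]mulrA; lra.
have Ex t : 0 < t < x -> defect_slope t < 0.
  move=> /andP[t0 tx].
  have dN (u : R) : 0 < u -> is_derive u (1 : R) (fun u => - weighted_slope u)
      (- (p * slope_rate u * expR (log_weight u))).
    by move=> u0; exact: is_deriveNf (is_derive_weighted_slope u0).
  suff : 0 < - weighted_slope t by rewrite oppr_gt0 /weighted_slope pmulr_llt0 // expR_gt0.
  apply: (gt0_of_derive dN (k := ((top_index * p) ^+ 2 + p * h) * expR (log_weight 1)) _ t0).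
    by move=> u u01; rewrite lerN2; apply: le_trans (ler_norm _) (weighted_slope_bound u01).
  move=> u /andP[u0 ut]; rewrite oppr_gt0 pmulr_llt0 ?expR_gt0 // pmulr_rlt0 //.
  by apply: Yx; rewrite u0 (lt_trans ut).
have x20 : 0 < x / 2 by rewrite divr_gt0.
exists (x / 2) => //; rewrite -oppr_gt0.
have dN (u : R) : 0 < u -> is_derive u (1 : R) (fun u => - defect u) (- defect_slope u).
  by move=> u0; exact: is_deriveNf (is_derive_defect u0).
apply: (gt0_of_derive dN (k := k) _ x20) => [t /kD|t /andP[t0 tx]].
  by rewrite lerN2.
by rewrite oppr_gt0 Ex // t0 /=; lra.
Qed.

End Defect.

(** * From the defect to admissibility *)

Section Link.
Context {R : realType}.
Implicit Types (x z u t p : R) (n r s : nat).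

Lemma G_geometric n u : G n u * (1 - u) = 1 - u ^+ n.+1.
Proof.
rewrite /G; elim: n => [|n IH]; first by rewrite big_ord1 expr0 mul1r expr1.
by rewrite big_ord_recr /= mulrDl IH [u ^+ n.+2]exprSr; ring.
Qed.

Lemma G_ge1 n u : 0 <= u -> 1 <= G n u.
Proof.
move=> u0; rewrite /G big_ord_recl expr0 lerDl sumr_ge0 // => i _.
exact: exprn_ge0.
Qed.

Lemma G_le_affine n u : 0 <= u <= 1 -> G n u <= 1 + n%:R * u.
Proof.
move=> /andP[u0 u1]; rewrite /G big_ord_recl expr0 lerD2l.
apply: le_trans (ler_sum _ (G := fun=> u) _) _ => [i _|].
  by rewrite exprS ler_piMr // exprn_ile1.
by rewrite sumr_const card_ord mulr_natl.
Qed.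

Lemma G_le n u : 0 <= u <= 1 -> G n u <= n.+1%:R.
Proof.
move=> u01; apply: le_trans (G_le_affine n u01) _.
have /andP[u0 u1] := u01; rewrite -natr1 addrC lerD2r.
by rewrite ler_piMr.
Qed.

Lemma G_ge n u : 0 <= u <= 1 -> n.+1%:R * u ^+ n <= G n u.
Proof.
move=> /andP[u0 u1]; rewrite /G mulr_natl.
have -> : u ^+ n *+ n.+1 = \sum_(i < n.+1) u ^+ n by rewrite sumr_const card_ord.
by apply: ler_sum => i _; apply: ler_wiXn2l => //; rewrite -ltnS ltn_ord.
Qed.

Lemma sinhE z : sinh z = expR z * (1 - expR (- (2 * z))) / 2.
Proof.
rewrite /sinh mulrBr mulr1 -expRD; congr ((_ - expR _) / _); ring.
Qed.

(** With the linear term removed this is h_n.  In the defect the linear terms cancel: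
the degree of G (r + s) is the sum of the degrees of G r and G s. *)
Lemma ln_G_expR n z : 0 < z ->
  ln (G n (expR (- (2 * z)))) = lsinh n.+1%:R z - lsinh 1 z - n%:R * z.
Proof.
move=> z0; set u := expR (- (2 * z)).
have nz0 : 0 < n.+1%:R * z by rewrite mulr_gt0.
have u1 : u < 1 by rewrite expR_lt1 oppr_lt0 mulr_gt0.
have s0 := sinh_gt0 z0; have sn0 := sinh_gt0 nz0.
have -> : G n u = sinh (n.+1%:R * z) / sinh z * expR (- (n%:R * z)).
  have e1 : 0 < 1 - u by rewrite subr_gt0.
  apply: (mulIf (lt0r_neq0 e1)); rewrite G_geometric.
  rewrite !sinhE -/u.
  have -> : u ^+ n.+1 = expR (- (2 * (n.+1%:R * z))).
    by rewrite /u -expRM_natl; congr expR; ring.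
  have -> : expR (n.+1%:R * z) = expR z * expR (n%:R * z).
    by rewrite -expRD; congr expR; rewrite -natr1; ring.
  have a0 : expR z != 0 by rewrite gt_eqF ?expR_gt0.
  have b0 : expR (n%:R * z) != 0 by rewrite gt_eqF ?expR_gt0.
  have e0 : 1 - u != 0 by exact: lt0r_neq0.
  by rewrite [expR (- (n%:R * z))]expRN; field; rewrite b0 e0 a0.
rewrite lnM; last 2 first.
- by rewrite posrE divr_gt0.
- by rewrite posrE expR_gt0.
by rewrite expRK ln_div ?posrE // /lsinh mul1r.
Qed.

Lemma defect_ln_G_powR r s p x : 0 < p -> 0 < x ->
  defect p r.+1%:R s.+1%:R x = ln (G (r + s) (expR (- (2 * x)) `^ p))
    - p * (ln (G r (expR (- (2 * x)))) + ln (G s (expR (- (2 * x))))).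
Proof.
move=> p0 x0.
have -> : expR (- (2 * x)) `^ p = expR (- (2 * (p * x))).
  by rewrite /powR gt_eqF ?expR_gt0 // expRK; congr expR; ring.
rewrite !ln_G_expR ?mulr_gt0 // /defect /lsinh.
have -> : top_index (r.+1%:R : R) s.+1%:R = (r + s).+1%:R.
  by rewrite /top_index -[r.+1]addn1 -[s.+1]addn1 -[(r + s).+1]addn1 !natrD; ring.
rewrite !mulrA !mul1r natrD; ring.
Qed.

Lemma powR_le_exp_iff (a b c p : R) : 0 < a -> 0 < b -> 0 < c ->
  (a `^ p * b `^ p <= c) = (0 <= ln c - p * (ln a + ln b)).
Proof.
move=> a0 b0 c0; rewrite subr_ge0 mulrDr -!ln_powR -lnM ?posrE ?powR_gt0 //.
by rewrite ler_ln ?posrE // mulr_gt0 // powR_gt0.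
Qed.

(** The first condition is the inequality at t = 1, that is, at x = 0. *)
Lemma admissible_iff r s p : 0 < p ->
  admissible r s p <->
    [/\ p * (ln r.+1%:R + ln s.+1%:R) <= ln (r + s).+1%:R
      & forall x, 0 < x -> 0 <= defect p r.+1%:R s.+1%:R x].
Proof.
move=> p0.
have Gt n t : 0 <= t -> 0 < G n t by exact: G_gt0.
have at1 : (G r 1 `^ p * G s 1 `^ p <= G (r + s) (1 `^ p)) =
   (p * (ln r.+1%:R + ln s.+1%:R) <= ln (r + s).+1%:R).
  by rewrite powR1 !G_at1 powR_le_exp_iff ?ltr0n // subr_ge0.
have atx x : 0 < x -> (G r (expR (- (2 * x))) `^ p * G s (expR (- (2 * x))) `^ p <=
     G (r + s) (expR (- (2 * x)) `^ p)) = (0 <= defect p r.+1%:R s.+1%:R x).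
  move=> x0; rewrite powR_le_exp_iff ?Gt ?expR_ge0 ?powR_ge0 //.
  by rewrite defect_ln_G_powR.
split=> [[pe|[_ h]]|[h1 hx]].
- by rewrite pe ltxx in p0.
- split; first by rewrite -at1 h // lexx ler01.
  move=> x x0; rewrite -atx // h // expR_ge0 expR_le1 oppr_le0.
  by rewrite mulr_ge0 // ltW.
- right; split=> // t /andP[t0 t1].
  move: t0; rewrite le_eqVlt => /orP[/eqP<-|t0].
    by rewrite powR0 ?gt_eqF // !G_at0 powR1 mulr1.
  move: t1; rewrite le_eqVlt => /orP[/eqP->|t1]; first by rewrite at1.
  have tE : t = expR (- (2 * (- ln t / 2))).
    by rewrite -[LHS]lnK ?posrE //; congr expR; field.
  rewrite tE atx; first by apply: hx; rewrite divr_gt0 // oppr_gt0 ln_lt0 // t0.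
  by rewrite divr_gt0 // oppr_gt0 ln_lt0 // t0.
Qed.

Lemma expRN2_01 z : 0 <= z -> 0 <= expR (- (2 * z)) <= 1.
Proof. by move=> z0; rewrite expR_ge0 expR_le1 oppr_le0 mulr_ge0. Qed.

Lemma ln_G_ge n z : 0 <= z -> ln n.+1%:R - n%:R * (2 * z) <= ln (G n (expR (- (2 * z)))).
Proof.
move=> z0; have /andP[u0 u1] := expRN2_01 z0.
have un0 : 0 < expR (- (2 * z)) ^+ n by rewrite exprn_gt0 // expR_gt0.
have -> : ln n.+1%:R - n%:R * (2 * z) = ln (n.+1%:R * expR (- (2 * z)) ^+ n).
  by rewrite lnM ?posrE ?ltr0n // -expRM_natl expRK mulrN.
rewrite ler_ln ?posrE ?mulr_gt0 ?ltr0n ?G_gt0 //.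
by apply: G_ge; rewrite u0.
Qed.

Lemma ln_G_le n z : 0 <= z -> ln (G n (expR (- (2 * z)))) <= ln n.+1%:R.
Proof.
move=> z0; rewrite ler_ln ?posrE ?ltr0n ?G_gt0 ?expR_ge0 //.
exact/G_le/expRN2_01.
Qed.

Lemma ln_G_le_expR n z : 0 <= z ->
  ln (G n (expR (- (2 * z)))) <= n%:R * expR (- (2 * z)).
Proof.
move=> z0; have g0 : 0 < G n (expR (- (2 * z))) by rewrite G_gt0 // expR_ge0.
rewrite -ler_expR lnK ?posrE //.
exact: le_trans (G_le_affine n (expRN2_01 z0)) (expR_ge1Dx _).
Qed.

Lemma ln_G_ge0 n u : 0 <= u -> 0 <= ln (G n u).
Proof. by move=> u0; rewrite ln_ge0 // G_ge1. Qed.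

Lemma defect_ln_G r s p x : 0 < p -> 0 < x ->
  defect p r.+1%:R s.+1%:R x = ln (G (r + s) (expR (- (2 * (p * x)))))
    - p * (ln (G r (expR (- (2 * x)))) + ln (G s (expR (- (2 * x))))).
Proof.
move=> p0 x0; rewrite defect_ln_G_powR //; congr (ln (G _ _) - _).
by rewrite /powR gt_eqF ?expR_gt0 // expRK; congr expR; ring.
Qed.

(** G n u lies between (n + 1) u^n and n + 1.  The hypothesis on p, which says p = a,
cancels the constants. *)
Lemma defect_near0 r s p x : 0 < p -> p * (ln r.+1%:R + ln s.+1%:R) = ln (r + s).+1%:R ->
  0 < x -> `|defect p r.+1%:R s.+1%:R x| <= 2 * p * (r + s)%:R * x.
Proof.
move=> p0 e x0; rewrite defect_ln_G // ler_norml.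
have px0 : 0 <= p * x by rewrite mulr_ge0 // ltW.
have h1 := ln_G_ge (r + s) px0; have h2 := ln_G_le (r + s) px0.
have := ler_wpM2l (ltW p0) (ln_G_ge r (ltW x0)).
have := ler_wpM2l (ltW p0) (ln_G_ge s (ltW x0)).
have := ler_wpM2l (ltW p0) (ln_G_le r (ltW x0)).
have := ler_wpM2l (ltW p0) (ln_G_le s (ltW x0)).
rewrite natrD in h1 *; move=> h3 h4 h5 h6.
by apply/andP; split; lra.
Qed.

(** G (r + s) is at least 1, and ln (G n u) <= n u. *)
Lemma defect_ge_expR r s p x : 0 < p -> 0 < x ->
  - (p * (r + s)%:R * expR (- (2 * x))) <= defect p r.+1%:R s.+1%:R x.
Proof.
move=> p0 x0; rewrite defect_ln_G //.
have h1 := ln_G_ge0 (r + s) (expR_ge0 (- (2 * (p * x)))).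
have := ler_wpM2l (ltW p0) (ln_G_le_expR r (ltW x0)).
have := ler_wpM2l (ltW p0) (ln_G_le_expR s (ltW x0)).
by rewrite natrD => h2 h3; lra.
Qed.

Lemma a_rs_mul r s : (0 < r)%N -> (0 < s)%N ->
  a_rs R r s * (ln r.+1%:R + ln s.+1%:R) = ln (r + s).+1%:R.
Proof.
move=> r0 s0; rewrite /a_rs !addn1 divfK // gt_eqF // addr_gt0 // ln_gt0 //.
  by rewrite ltr1n ltnS.
by rewrite ltr1n ltnS.
Qed.

Lemma a_rs_in01 r s : (0 < r)%N -> (0 < s)%N -> 0 < a_rs R r s < 1.
Proof.
move=> r0 s0.
have lr : 0 < ln r.+1%:R :> R by rewrite ln_gt0 // ltr1n ltnS.
have ls : 0 < ln s.+1%:R :> R by rewrite ln_gt0 // ltr1n ltnS.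
rewrite /a_rs !addn1 divr_gt0 ?addr_gt0 ?ln_gt0 ?ltr1n ?ltnS ?addn_gt0 ?r0 //=.
rewrite ltr_pdivrMr ?addr_gt0 // mul1r -lnM ?posrE ?ltr0n //.
rewrite ltr_ln ?posrE ?mulr_gt0 ?ltr0n // -natrM ltr_nat; nia.
Qed.

Lemma b_rs_le r s p : (0 < r)%N -> (0 < s)%N ->
  (b_rs R r s <= p) = (0 <= excess p r.+1%:R s.+1%:R).
Proof.
move=> r0 s0; have r0' : 0 < r%:R :> R by rewrite ltr0n.
have s0' : 0 < s%:R :> R by rewrite ltr0n.
rewrite /b_rs ler_pdivrMr; last by rewrite mulr_gt0 // !addr_gt0.
rewrite -subr_ge0; congr (0 <= _).
by rewrite /excess /top_index -[r.+1]addn1 -[s.+1]addn1 !natrD; ring.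
Qed.

(** If the defect had the value - d < 0 at x, it would be at most - d from x on,
against its lower bound - p (r + s) exp (-2 y) at infinity. *)
Lemma admissible_a_rs r s : (0 < s)%N -> (s <= r)%N ->
  admissible r s (a_rs R r s) <-> b_rs R r s <= a_rs R r s.
Proof.
move=> s0 sr; have r0 := leq_trans s0 sr.
have /andP[a0 a1] := a_rs_in01 r0 s0; have am := a_rs_mul r0 s0.
move: (a_rs R r s) a0 a1 am => p p0 p1 pe.
have s1 : (1 : R) < s.+1%:R by rewrite ltr1n ltnS.
have sr' : s.+1%:R <= r.+1%:R :> R by rewrite ler_nat ltnS.
have Dle t : 0 < t < 1 -> defect p r.+1%:R s.+1%:R t <= 2 * p * (r + s)%:R * t.
  by move=> /andP[t0 _]; apply: le_trans (ler_norm _) (defect_near0 p0 pe t0).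
have Dge t : 0 < t < 1 -> - (2 * p * (r + s)%:R * t) <= defect p r.+1%:R s.+1%:R t.
  by move=> /andP[t0 _]; have := defect_near0 p0 pe t0; rewrite ler_norml => /andP[].
rewrite admissible_iff // b_rs_le //; split=> [[_ D0]|C0].
  rewrite leNgt; apply/negP => C0.
  have [x x0] := defect_lt0_near0 p0 p1 s1 sr' C0 Dle.
  by rewrite ltNge D0.
split=> [|x x0]; first by rewrite pe.
rewrite leNgt; apply/negP => Dx.
pose d := - defect p r.+1%:R s.+1%:R x.
have d0 : 0 < d by rewrite oppr_gt0.
(* At this y the bound p (r + s) exp (-2 y) is below d, because
   exp (2 y) >= 1 + 2 y. *)
pose y : R := x + p * (r + s)%:R / d.
have xy : x <= y by rewrite lerDl divr_ge0 ?mulr_ge0 // ltW.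
have y0 := lt_le_trans x0 xy.
have := defect_nincr p0 p1 s1 sr' C0 Dge x0 Dx xy.
have := defect_ge_expR r s p0 y0.
suff : p * (r + s)%:R * expR (- (2 * y)) < d by rewrite /d; lra.
rewrite expRN ltr_pdivrMr ?expR_gt0 //.
apply: (@lt_le_trans _ _ (d * (1 + 2 * y))); last first.
  by rewrite ler_pM2l // expR_ge1Dx.
have dy : d * y = d * x + p * (r + s)%:R.
  by rewrite /y mulrDr mulrC [d * (_ / _)]mulrC divfK // gt_eqF.
have dx0 : 0 < d * x by rewrite mulr_gt0.
have pn0 : 0 <= p * (r + s)%:R by rewrite mulr_ge0 // ltW.
have -> : d * (1 + 2 * y) = d + 2 * (d * y) by ring.
by rewrite dy; lra.
Qed.

Lemma admissibleC r s p : admissible r s p -> admissible s r p.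
Proof.
case=> [->|[p0 h]]; first by left.
by right; split=> // t t01; rewrite addnC mulrC h.
Qed.

End Link.

Theorem theorem1p1 (R : realType) (r s : nat) (hr : (0 < r)%N) (hs : (0 < s)%N) :
  largest_admissible R r s = a_rs R r s <-> a_rs R r s >= b_rs R r s.
Proof.
have [pa pmax] := largest_admissibleP R hr hs.
have -> : (largest_admissible R r s = a_rs R r s) <-> admissible r s (a_rs R r s).
  split=> [<- //|aa]; apply/eqP; rewrite eq_le pmax // andbT.
  exact: admissible_le_a_rs.
have [sr|/ltnW rs] := leqP s r; first exact: admissible_a_rs.
have aC : a_rs R r s = a_rs R s r.
  by rewrite /a_rs [(r + s)%N]addnC [ln (r + 1)%:R + _]addrC.
have bC : b_rs R r s = b_rs R s r.
  by rewrite /b_rs [r%:R * _ + _]addrC [r%:R + s%:R]addrC.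
rewrite aC bC -(admissible_a_rs hr rs).
by split; exact: admissibleC.
Qed.
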